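(* The language preservation problem for parametric event-recording automata remains undecidable when the untimed language is defined as the set of untimed words of all finite runs (without accepting locations). That is, there is no algorithm that, given as input a parametric event-recording automaton $\mathsf{A}$ with parameter set $P$ and a parameter valuation $v : P \to \mathbb{Q}_{+}$, decides whether there exists a parameter valuation $v' : P \to \mathbb{Q}_{+}$ with $v' \neq v$ such that $\mathsf{UL}_{S}(v'(\mathsf{A})) = \mathsf{UL}_{S}(v(\mathsf{A}))$, where $\mathsf{UL}_{S}(v(\mathsf{A}))$ is the set of untimed words associated with any finite run (maximal or not) of $v(\mathsf{A})$.
   Context: $\mathbb{Q}_{+}$ and $\mathbb{R}_{+}$ denote the non-negative rationals and non-negative reals. Clocks are real-valued variables that evolve at the same rate. For a set $X$ of clocks, a clock valuation is a function $\mu : X \to \mathbb{R}_{+}$; $\vec{0}$ is the valuation assigning $0$ to all clocks; for $d \in \mathbb{R}_{+}$, $(\mu+d)(x) = \mu(x)+d$ for all $x \in X$; for $x \in X$, $[\mu]_x$ is the valuation with $[\mu]_x(x) = 0$ and $[\mu]_x(x') = \mu(x')$ for $x' \neq x$. Parameters are unknown rational constants; for a set $P$ of parameters, a parameter valuation is a function $v : P \to \mathbb{Q}_{+}$. A guard $g$ over $X \cup P$ is a conjunction of inequalities $x \bowtie \eta$ with $x \in X$, $\eta$ either a parameter in $P$ or a constant in $\mathbb{Z}$, and ${\bowtie} \in \{<,\leq,\geq,>\}$. $v(g)$ is $g$ with each parameter $p$ replaced by $v(p)$. A parametric event-recording automaton (PERA) is a tuple $\mathsf{A} = (\Sigma,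 L, l_0, P, I, E)$ where $\Sigma$ is a finite set of actions, $L$ is a finite set of locations, $l_0 \in L$ is the initial location, $P$ is a finite set of parameters, $I$ assigns to every $l \in L$ a guard $I(l)$ (the invariant), and $E$ is a finite set of edges $e = (l, g, a, l')$ with $l,l' \in L$, $a \in \Sigma$ and $g$ a guard. The clocks are $X_\Sigma = \{x_a : a \in \Sigma\}$, one clock $x_a$ per action $a$; guards are over $X_\Sigma \cup P$, and $x_a$ is implicitly reset exactly on transitions labeled with $a$. For a parameter valuation $v$, $v(\mathsf{A})$ denotes the (non-parametric) automaton obtained by replacing each parameter $p$ by $v(p)$. Semantics of $v(\mathsf{A})$: the states are $S = \{(l,\mu) \in L \times \mathbb{R}_{+}^{|X_\Sigma|} : \mu \models v(I(l))\}$, and the initial state is $s_0 = (l_0, \vec{0})$. Discrete transitions: $(l,\mu) \xrightarrow{e} (l',\mu')$ if $(l,\mu),(l',\mu') \in S$ and there is $e = (l,g,a,l') \in E$ with $\mu' = [\mu]_{x_a}$ and $\mu \models v(g)$. Delay transitions: $(l,\mu) \xrightarrow{d} (l,\mu+d)$ for $d \in \mathbb{R}_{+}$ if $(l,\mu+d') \in S$ for all $d' \in [0,d]$. A run is a finite or infinite sequence $s_0 \xrightarrow{(d_0,e_0)} s_1 \xrightarrow{(d_1,e_1)} \cdots$ starting in the initial state, where each step is a delay $d_i$ followed by a discrete transition along $e_i$. Its untimed word is $a_0 a_1 \cdots$, where $a_i$ is the action of $e_i$. *)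

(* Defs.v *)
From HB Require Import structures.
From mathcomp Require Import all_boot all_order all_algebra.
From mathcomp Require Import interval_inference.
From mathcomp Require Import boolp classical_sets reals.
Set Implicit Arguments.
Unset Strict Implicit.
Unset Printing Implicit Defensive.
Import Order.TTheory GRing.Theory Num.Theory.
Local Open Scope classical_set_scope.
Local Open Scope ring_scope.

(** * Guards and event-recording automata *)

Variant cmp_op := OpLt | OpLe | OpGe | OpGt.

Definition code_cmp (c : cmp_op) : nat :=
  match c with OpLt => 0%N | OpLe => 1%N | OpGe => 2%N | OpGt => 3%N end.

Definition decode_cmp (n : nat) : cmp_op :=
  match n with 0 => OpLt | 1 => OpLe | 2 => OpGe | _ => OpGt end.

Lemma code_cmpK : cancel code_cmp decode_cmp.
Proof. by case. Qed.

HB.instance Definition _ := Equality.copy cmp_op (can_type code_cmpK).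

Definition cmp_rel (F : numDomainType) (c : cmp_op) : rel F :=
  match c with
  | OpLt => fun x y => x < y
  | OpLe => fun x y => x <= y
  | OpGe => fun x y => x >= y
  | OpGt => fun x y => x > y
  end.

(* The clock x_a is identified with the action a. [K] is the type of the
   right-hand sides: [P + int] for a parametric guard, [rat] for its instance
   under a parameter valuation. The empty conjunction is the guard "true". *)
Definition guard (Sigma K : Type) : Type := seq (Sigma * cmp_op * K).

Definition edge (Sigma L K : Type) : Type :=
  (L * guard Sigma K * Sigma * L)%type.

(* Only membership in [edges] matters: the list stands for the finite set E. *)
Record automaton (Sigma : Type) (L : finType) (K : Type) := Automaton {
  init : L;
  invariant : {ffun L -> guard Sigma K};
  edges : seq (edge Sigma L K)
}.

Definition pera (Sigma L P : finType) := automaton Sigma L (P + int)%type.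

Definition era (Sigma L : finType) := automaton Sigma L rat.

Definition param_valuation (P : finType) := {ffun P -> {nonneg rat}}.

Section Instantiation.
Variables (Sigma L P : finType) (v : param_valuation P).

Definition inst_operand (k : P + int) : rat :=
  match k with inl p => (v p)%:num | inr z => z%:~R end.

Definition inst_guard (g : guard Sigma (P + int)) : guard Sigma rat :=
  [seq (c.1, inst_operand c.2) | c <- g].

Definition inst_edge (e : edge Sigma L (P + int)) : edge Sigma L rat :=
  let: (l, g, a, l') := e in (l, inst_guard g, a, l').

Definition inst (A : pera Sigma L P) : era Sigma L :=
  {| init := init A;
     invariant := [ffun l => inst_guard (invariant A l)];
     edges := [seq inst_edge e | e <- edges A] |}.

End Instantiation.

(** * Semantics *)

Section Semantics.
Variables (R : realType) (Sigma L : finType) (A : era Sigma L).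

Definition clock_valuation := {ffun Sigma -> {nonneg R}}.

Definition zero_valuation : clock_valuation := [ffun=> 0%:nng].

Definition elapse (mu : clock_valuation) (d : {nonneg R}) : clock_valuation :=
  [ffun x => ((mu x)%:num + d%:num)%:nng].

Definition reset (mu : clock_valuation) (a : Sigma) : clock_valuation :=
  [ffun x => if x == a then 0%:nng else mu x].

Definition satisfies (mu : clock_valuation) (g : guard Sigma rat) : bool :=
  all (fun c => let: (x, op, q) := c in cmp_rel op (mu x)%:num (ratr q)) g.

(* [is_state] carves the set S out of all pairs of a location and a clock
   valuation. *)
Definition config : Type := (L * clock_valuation)%type.

Definition is_state (s : config) : bool := satisfies s.2 (invariant A s.1).

Definition init_config : config := (init A, zero_valuation).

Definition discrete_step (s : config) (e : edge Sigma L rat) (s' : config) :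
    Prop :=
  let: (l, g, a, l') := e in
  [/\ is_state s /\ is_state s', e \in edges A, s.1 = l /\ s'.1 = l',
      s'.2 = reset s.2 a & satisfies s.2 g].

Definition delay_step (s : config) (d : {nonneg R}) (s' : config) : Prop :=
  s' = (s.1, elapse s.2 d) /\
  forall d' : {nonneg R}, d'%:num <= d%:num -> is_state (s.1, elapse s.2 d').

Fixpoint run_from (s : config) (r : seq ({nonneg R} * edge Sigma L rat)) :
    Prop :=
  match r with
  | [::] => True
  | (d, e) :: r' => exists s1 s2 : config,
      [/\ delay_step s d s1, discrete_step s1 e s2 & run_from s2 r']
  end.

(* A run is a sequence of states, so there is none, not even the empty one,
   when the initial configuration violates its invariant. *)
Definition finite_run (r : seq ({nonneg R} * edge Sigma L rat)) : Prop :=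
  is_state init_config /\ run_from init_config r.

Definition edge_action (e : edge Sigma L rat) : Sigma :=
  let: (_, _, a, _) := e in a.

Definition untimed_word (r : seq ({nonneg R} * edge Sigma L rat)) :
    seq Sigma :=
  [seq edge_action step.2 | step <- r].

Definition UL : set (seq Sigma) :=
  [set w | exists2 r, finite_run r & w = untimed_word r].

End Semantics.

(** * The language preservation problem *)

Definition language_preserved (R : realType) (Sigma L P : finType)
    (A : pera Sigma L P) (v : param_valuation P) : Prop :=
  exists v' : param_valuation P,
    v' <> v /\ UL R (inst v' A) = UL R (inst v A).

(* Up to renaming, the actions, locations and parameters of an input are
   initial segments of the natural numbers. *)
Record lp_instance := LPInstance {
  n_act : nat;
  n_loc : nat;
  n_par : nat;
  lp_pera : pera 'I_n_act 'I_n_loc 'I_n_par;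
  lp_val : param_valuation 'I_n_par
}.

Definition language_preservation (R : realType) (i : lp_instance) : Prop :=
  language_preserved R (lp_pera i) (lp_val i).

(** * Effective encoding of the inputs *)

(* [CodeSeq.code] is the bijection from [seq nat] to [nat] sending
   [:: n1; n2; ..] to 2 ^ n1 * (2 * code [:: n2; ..] + 1), and [::] to 0. *)
Section Encoding.
Variables (m n p : nat).
Local Notation code := CodeSeq.code.

Definition code_int (z : int) : nat :=
  match z with Posz k => k.*2 | Negz k => k.*2.+1 end.

Definition code_rat (q : rat) : nat :=
  code [:: code_int (numq q); code_int (denq q)].

Definition code_operand (k : 'I_p + int) : nat :=
  match k with
  | inl j => code [:: 0%N; val j]
  | inr z => code [:: 1%N; code_int z]
  end.

Definition code_constraint (c : 'I_m * cmp_op * ('I_p + int)) : nat :=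
  code [:: val c.1.1; code_cmp c.1.2; code_operand c.2].

Definition code_guard (g : guard 'I_m ('I_p + int)) : nat :=
  code [seq code_constraint c | c <- g].

Definition code_edge (e : edge 'I_m 'I_n ('I_p + int)) : nat :=
  let: (l, g, a, l') := e in
  code [:: val l; code_guard g; val a; val l'].

Definition code_pera (A : pera 'I_m 'I_n 'I_p) : nat :=
  code [:: val (init A);
           code [seq code_guard (invariant A l) | l <- enum 'I_n];
           code [seq code_edge e | e <- edges A]].

Definition code_valuation (v : param_valuation 'I_p) : nat :=
  code [seq code_rat (v j)%:num | j <- enum 'I_p].

End Encoding.

Definition code_instance (i : lp_instance) : nat :=
  CodeSeq.code [:: n_act i; n_loc i; n_par i;
                   code_pera (lp_pera i); code_valuation (lp_val i)].

Lemma code_inj : injective CodeSeq.code.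
Proof. exact: can_inj CodeSeq.codeK. Qed.

Lemma code_int_inj : injective code_int.
Proof.
move=> [a|a] [b|b] /= => [/double_inj -> //| /(congr1 odd) | /(congr1 odd) |].
- by rewrite /= !odd_double.
- by rewrite /= !odd_double.
- by move=> [] /double_inj ->.
Qed.

Lemma code_rat_inj : injective code_rat.
Proof.
move=> x y /code_inj E.
have /code_int_inj En := congr1 (nth 0%N ^~ 0%N) E.
have /code_int_inj Ed := congr1 (nth 0%N ^~ 1%N) E.
by rewrite -[x]divq_num_den -[y]divq_num_den En Ed.
Qed.

Lemma code_operand_inj p : injective (@code_operand p).
Proof.
move=> [j|z] [j'|z'] /code_inj E.
- by have /val_inj -> := congr1 (nth 0%N ^~ 1%N) E.
- by have := congr1 (nth 0%N ^~ 0%N) E.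
- by have := congr1 (nth 0%N ^~ 0%N) E.
- by have /code_int_inj -> := congr1 (nth 0%N ^~ 1%N) E.
Qed.

Lemma code_guard_inj m p : injective (@code_guard m p).
Proof.
move=> g h /code_inj; apply: inj_map => -[[x o] k] [[x' o'] k'] /code_inj E.
have /val_inj /= -> := congr1 (nth 0%N ^~ 0%N) E.
have /(can_inj code_cmpK) /= -> := congr1 (nth 0%N ^~ 1%N) E.
by have /code_operand_inj /= -> := congr1 (nth 0%N ^~ 2%N) E.
Qed.

Lemma code_edge_inj m n p : injective (@code_edge m n p).
Proof.
move=> [[[l g] a] l'] [[[k h] b] k'] /code_inj E.
have /val_inj /= -> := congr1 (nth 0%N ^~ 0%N) E.
have /code_guard_inj /= -> := congr1 (nth 0%N ^~ 1%N) E.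
have /val_inj /= -> := congr1 (nth 0%N ^~ 2%N) E.
by have /val_inj /= -> := congr1 (nth 0%N ^~ 3%N) E.
Qed.

Lemma code_pera_inj m n p : injective (@code_pera m n p).
Proof.
move=> [i I E] [i' I' E'] /code_inj eqA.
have /val_inj /= -> := congr1 (nth 0%N ^~ 0%N) eqA.
have /code_inj /= /eq_in_map eqI := congr1 (nth 0%N ^~ 1%N) eqA.
have /code_inj /(inj_map (@code_edge_inj m n p)) /= -> :=
  congr1 (nth 0%N ^~ 2%N) eqA.
have -> // : I = I'.
by apply/ffunP=> l; apply/code_guard_inj/eqI; rewrite mem_enum.
Qed.

Lemma code_valuation_inj p : injective (@code_valuation p).
Proof.
move=> v w /code_inj /eq_in_map eqv.
by apply/ffunP=> j; apply/val_inj/code_rat_inj/eqv; rewrite mem_enum.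
Qed.

Lemma code_instance_inj : injective code_instance.
Proof.
move=> [m n p A v] [m' n' p' A' v'] /code_inj E.
have /= Em := congr1 (nth 0%N ^~ 0%N) E.
have /= En := congr1 (nth 0%N ^~ 1%N) E.
have /= Ep := congr1 (nth 0%N ^~ 2%N) E.
subst m' n' p'.
have /code_pera_inj /= -> := congr1 (nth 0%N ^~ 3%N) E.
by have /code_valuation_inj /= -> := congr1 (nth 0%N ^~ 4%N) E.
Qed.

(** * Algorithms: partial recursive functions *)

(* A partial function from nat ^ n to nat is represented by its graph. *)
Definition pfun (n : nat) : Type := n.-tuple nat -> nat -> Prop.

Definition pf_comp n k (f : pfun k) (g : 'I_k -> pfun n) : pfun n :=
  fun x y => exists w : k.-tuple nat,
    (forall i, g i x (tnth w i)) /\ f w y.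

Fixpoint pf_prec_at n (f : pfun n) (g : pfun n.+2) (k : nat)
    (x : n.-tuple nat) (y : nat) : Prop :=
  match k with
  | 0 => f x y
  | k'.+1 => exists z : nat,
      pf_prec_at f g k' x z /\ g (cons_tuple k' (cons_tuple z x)) y
  end.

Definition pf_prec n (f : pfun n) (g : pfun n.+2) : pfun n.+1 :=
  fun x => pf_prec_at f g (thead x) (behead_tuple x).

Definition pf_mu n (f : pfun n.+1) : pfun n :=
  fun x y => f (cons_tuple y x) 0%N /\
    forall z : nat, (z < y)%N -> exists t : nat, f (cons_tuple z x) t.+1.

Inductive partial_recursive : forall n : nat, pfun n -> Prop :=
| PR_zero n : @partial_recursive n (fun _ y => y = 0%N)
| PR_succ : @partial_recursive 1 (fun x y => y = (thead x).+1)
| PR_proj n (i : 'I_n) : @partial_recursive n (fun x y => y = tnth x i)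
| PR_comp n k (f : pfun k) (g : 'I_k -> pfun n) :
    partial_recursive f -> (forall i, partial_recursive (g i)) ->
    partial_recursive (pf_comp f g)
| PR_prec n (f : pfun n) (g : pfun n.+2) :
    partial_recursive f -> partial_recursive g ->
    partial_recursive (pf_prec f g)
| PR_mu n (f : pfun n.+1) :
    partial_recursive f -> partial_recursive (pf_mu f).

(* A partial recursive function that terminates on the code of every instance,
   answering 1 on positive and 0 on negative instances; its behaviour on
   numbers that are not codes is unconstrained. *)
Definition algorithmically_decidable (T : Type) (code : T -> nat)
    (Q : T -> Prop) : Prop :=
  exists f : pfun 1, partial_recursive f /\
    forall t : T, (Q t -> f [tuple code t] 1%N) /\
                  (~ Q t -> f [tuple code t] 0%N).

(* Main.v *)
Require Import Defs.
From HB Require Import structures.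
From mathcomp Require Import all_boot all_order all_algebra reals.
From mathcomp Require Import interval_inference boolp classical_sets.
From mathcomp Require Import zify lra.

(** A decision procedure [f] is refuted by an automaton that simulates a counter
    machine running [f] on the code of that very automaton.

    The automaton has clocks x_i, z_i for each counter i, and the only words it
    can read, apart from those of the pinning gadgets, are the prefixes of
    (x_0 z_0 x_1 z_1 ...)^omega. Each clock is reset once per cycle, z_i exactly
    P time units after its previous reset; counter i is the delay from x_i to
    z_i. Resetting x_i after P, P - 1 or P + 1 time units keeps, increments or
    decrements the counter, and x_i = 0 at the reset of z_i tests it for zero.
    Thus the word never depends on the control path, and the delays that fit
    between consecutive letters bound all the counters by P + 1. One counter
    counts the cycles, so that for a given P the simulation either halts, after
    which every continuation is allowed, or gets stuck. With all the period
    parameters equal to 0 the automaton reads the cycle freely; hence another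
    valuation has the same language iff some P is large enough for a halting
    computation.

    The inputs of the machine are two further parameters K and C. Gadgets put
    into the language the word (g u^j x_0) exactly when j is the value of the
    parameter, so these two cannot change. Since the code of the instance is of
    the form a + b * t(K, C) with t recursive and a, b depending on the automaton
    only, the choice K = a, C = b lets the machine compute its own code. *)

Set Implicit Arguments.
Unset Strict Implicit.
Unset Printing Implicit Defensive.

(** * Counter machines *)

Definition upd (T : Type) (s : nat -> T) (r : nat) (v : T) : nat -> T :=
  fun x => if x == r then v else s x.

Variant op_kind := KInc | KDec | KZero | KNop.

Definition code_kind (k : op_kind) : nat :=
  match k with KInc => 0 | KDec => 1 | KZero => 2 | KNop => 3 end.

Definition decode_kind (n : nat) : op_kind :=
  match n with 0 => KInc | 1 => KDec | 2 => KZero | _ => KNop end.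

Lemma code_kindK : cancel code_kind decode_kind.
Proof. by case. Qed.

HB.instance Definition _ := Equality.copy op_kind (can_type code_kindK).

Definition op := (op_kind * nat)%type.
Definition transition := (nat * op * nat)%type.
Definition regs := nat -> nat.

Definition op_rel (o : op) (c c' : regs) : Prop :=
  match o.1 with
  | KInc => c' = upd c o.2 (c o.2).+1
  | KDec => 0 < c o.2 /\ c' = upd c o.2 (c o.2).-1
  | KZero => c o.2 = 0 /\ c' = c
  | KNop => c' = c
  end.

Definition mstep (tr : seq transition) (x y : nat * regs) : Prop :=
  exists2 o, (x.1, o, y.1) \in tr & op_rel o x.2 y.2.

Inductive star (tr : seq transition) : nat * regs -> nat * regs -> Prop :=
| star_refl x : star tr x x
| star_step x y z : mstep tr x y -> star tr y z -> star tr x z.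

Lemma star_trans tr x y z : star tr x y -> star tr y z -> star tr x z.
Proof. by elim=> // {}x u {}y xu _ IH /IH; apply: star_step. Qed.

(** A syntactic condition: distinct transitions may leave a location only as the two branches of one
    zero test, which no register contents enable together. *)
Definition deterministic (tr : seq transition) : Prop :=
  forall p o1 q1 o2 q2, (p, o1, q1) \in tr -> (p, o2, q2) \in tr ->
  [\/ (o1, q1) = (o2, q2),
      exists r, o1 = (KDec, r) /\ o2 = (KZero, r) |
      exists r, o1 = (KZero, r) /\ o2 = (KDec, r)].

Lemma mstep_det tr x y z :
  deterministic tr -> mstep tr x y -> mstep tr x z -> y = z.
Proof.
case: x y z => [p c] [q1 c1] [q2 c2] D [o1 /= i1 r1] [o2 /= i2 r2].
have [[eo eq]|[r [e1 e2]]|[r [e1 e2]]] := D _ _ _ _ _ i1 i2.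
- rewrite -{}eo -{}eq {i1 i2 o2 q2} in r2 *; congr (_, _).
  case: o1 r1 r2 => [[] r]; rewrite /op_rel /=.
  + by move=> -> ->.
  + by move=> [_ ->] [_ ->].
  + by move=> [_ ->] [_ ->].
  + by move=> -> ->.
- by move: r1 r2; rewrite e1 e2 /op_rel /= => -[p0 _] [z0 _]; rewrite z0 in p0.
- by move: r1 r2; rewrite e1 e2 /op_rel /= => -[z0 _] [p0 _]; rewrite z0 in p0.
Qed.

(** Used to refute halting: a computation known to get stuck elsewhere cannot also reach the halting
    location. *)
Lemma star_stuck_unique tr x y z : deterministic tr ->
  (forall u, ~ mstep tr y u) -> (forall u, ~ mstep tr z u) ->
  star tr x y -> star tr x z -> y = z.
Proof.
move=> D sy sz xy; elim: xy sy => {x y} [x sx xz|x u y xu _ IH sy xz].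
  by case: xz sx => // ? ? ? st _ /(_ _ st).
apply: IH => //; case: xz sz xu => [{}x sx /sx //|{}x v {}z xv vz _ xu].
by rewrite (mstep_det D xu xv).
Qed.

(** * Structured programs *)

(* [Loop r c] is "while r > 0 do (r := r - 1; c)". *)
Inductive cmd := Skip | Inc of nat | Seq of cmd & cmd | Loop of nat & cmd.

Inductive exec : cmd -> regs -> regs -> Prop :=
| exec_skip s : exec Skip s s
| exec_inc r s : exec (Inc r) s (upd s r (s r).+1)
| exec_seq c d s s1 s2 : exec c s s1 -> exec d s1 s2 -> exec (Seq c d) s s2
| exec_loop0 r c s : s r = 0 -> exec (Loop r c) s s
| exec_loopS r c s s1 s2 : 0 < s r -> exec c (upd s r (s r).-1) s1 ->
    exec (Loop r c) s1 s2 -> exec (Loop r c) s s2.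

Fixpoint clen (c : cmd) : nat :=
  match c with
  | Skip => 0
  | Inc _ => 1
  | Seq c d => clen c + clen d
  | Loop _ c => (clen c).+2
  end.

(** The code of [c] occupies the locations from [p] up to its exit [p + clen c], excluded. The
    [KNop] transition of a loop jumps back to its test; the register 0 in it is a dummy. *)
Fixpoint compile (c : cmd) (p : nat) : seq transition :=
  match c with
  | Skip => [::]
  | Inc r => [:: (p, (KInc, r), p.+1)]
  | Seq c d => compile c p ++ compile d (p + clen c)
  | Loop r c => [:: (p, (KDec, r), p.+1), (p, (KZero, r), p + (clen c).+2),
                    (p.+1 + clen c, (KNop, 0), p) & compile c p.+1]
  end.

Lemma compile_correct tr c s s' p : exec c s s' ->
  {subset compile c p <= tr} -> star tr (p, s) (p + clen c, s').
Proof.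
move=> ex; elim: ex p => {c s s'} [s|r s|c d s s1 s2 _ IHc _ IHd|r c s s0|
  r c s s1 s2 s0 _ IHc _ IHl] p sub /=.
- by rewrite addn0; apply: star_refl.
- rewrite addn1; apply: star_step (star_refl _ _).
  by exists (KInc, r) => //; apply: sub; rewrite mem_seq1.
- rewrite addnA; apply: star_trans (IHc p _) (IHd _ _) => x xin; apply: sub.
    by rewrite /= mem_cat xin.
  by rewrite /= mem_cat xin orbT.
- apply: star_step (star_refl _ _).
  by exists (KZero, r) => //; apply: sub; rewrite /= !inE eqxx orbT.
- apply: (@star_step _ _ (p.+1, upd s r (s r).-1)).
    by exists (KDec, r) => //; apply: sub; rewrite /= !inE eqxx.
  apply: star_trans (IHc p.+1 _) _.
    by move=> x xin; apply: sub; rewrite /= !inE xin !orbT.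
  apply: (@star_step _ _ (p, s1)); last exact: IHl.
  by exists (KNop, 0) => //; apply: sub; rewrite /= !inE eqxx !orbT.
Qed.

Lemma compile_src c p q o q' :
  (q, o, q') \in compile c p -> p <= q < p + clen c.
Proof.
elim: c p => [//|r|c IHc d IHd|r c IHc] p /=.
- by rewrite inE => /eqP[-> _ _]; lia.
- by rewrite mem_cat => /orP[/IHc|/IHd]; lia.
- by rewrite !inE => /or4P[/eqP[-> _ _]|/eqP[-> _ _]|/eqP[-> _ _]|/IHc]; lia.
Qed.

Lemma compile_det c p : deterministic (compile c p).
Proof.
elim: c p => [//|r|c IHc d IHd|r c IHc] p q o1 q1 o2 q2 /=.
- by rewrite !inE => /eqP[_ -> ->] /eqP[_ -> ->]; constructor 1.
- rewrite !mem_cat => /orP[i1|i1] /orP[i2|i2].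
  + exact: IHc i1 i2.
  + by have := compile_src i1; have := compile_src i2; lia.
  + by have := compile_src i1; have := compile_src i2; lia.
  + exact: IHd i1 i2.
- rewrite !inE => /or4P[/eqP[e1 -> ->]|/eqP[e1 -> ->]|/eqP[e1 -> ->]|i1]
    /or4P[/eqP[e2 -> ->]|/eqP[e2 -> ->]|/eqP[e2 -> ->]|i2];
    try (by constructor 1); try (by exfalso; lia);
    try (by exfalso; have := compile_src i1; lia);
    try (by exfalso; have := compile_src i2; lia).
  + by constructor 2; exists r.
  + by constructor 3; exists r.
  + exact: IHc i1 i2.
Qed.

(** * Partial recursive functions as structured programs *)

Lemma exec_eq c s s1 s2 : exec c s s1 -> s1 =1 s2 -> exec c s s2.
Proof. by move=> ex /funext <-. Qed.

Ltac upd_tac :=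
  rewrite /upd /=; repeat (case: eqP => //= ?); subst; try lia.

(** A rule for loops with [k] rounds: [S j] is the state after [j] rounds, when the loop register
    holds [k - j]. *)
Lemma exec_loop_iter r c k (S : nat -> regs) s s' :
  s =1 S 0 -> S k =1 s' -> S k r = 0 ->
  (forall j, j < k -> S j r = k - j /\
     exec c (upd (S j) r (k - j).-1) (S j.+1)) ->
  exec (Loop r c) s s'.
Proof.
move=> /funext-> /funext<- Sk H.
suff E j : j <= k -> exec (Loop r c) (S (k - j)) (S k).
  by have := E k (leqnn k); rewrite subnn.
elim: j => [_|j IH jk]; first by rewrite subn0; apply: exec_loop0.
have lt : k - j.+1 < k by lia.
have [e ex] := H _ lt; apply: exec_loopS (IH (ltnW jk)); first by lia.
by rewrite e; move: ex; have -> : (k - j.+1).+1 = k - j by lia.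
Qed.

Definition clear r := Loop r Skip.

Lemma exec_clear r s : exec (clear r) s (upd s r 0).
Proof.
apply: (@exec_loop_iter _ _ (s r) (fun j => upd s r (s r - j))).
- by move=> x; upd_tac.
- by move=> x; upd_tac.
- by upd_tac.
- move=> j jk; split; first by upd_tac.
  by apply: exec_eq (exec_skip _) _ => x; upd_tac.
Qed.

Definition move a d := Loop a (Inc d).

Lemma exec_move a d s : a != d ->
  exec (move a d) s (upd (upd s d (s d + s a)) a 0).
Proof.
move=> /eqP ad.
apply: (@exec_loop_iter _ _ (s a)
  (fun j => upd (upd s d (s d + j)) a (s a - j))).
- by move=> x; upd_tac.
- by move=> x; upd_tac.
- by upd_tac.
- move=> j jk; split; first by upd_tac.
  by apply: exec_eq (exec_inc _ _) _ => x; upd_tac.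
Qed.

Definition copy a d t := Seq (Loop a (Seq (Inc d) (Inc t))) (move t a).

Lemma exec_copy a d t s : a != d -> a != t -> d != t -> s t = 0 ->
  exec (copy a d t) s (upd s d (s d + s a)).
Proof.
move=> /eqP ad /eqP at_ /eqP dt t0.
pose S j := upd (upd (upd s d (s d + j)) a (s a - j)) t j.
apply: (@exec_seq _ _ _ (S (s a))).
  apply: (@exec_loop_iter _ _ (s a) S) => //.
  - by move=> x; rewrite /S; upd_tac.
  - by rewrite /S; upd_tac.
  move=> j jk; split; first by rewrite /S; upd_tac.
  apply: exec_eq (exec_seq (exec_inc _ _) (exec_inc _ _)) _ => x.
  by rewrite /S; upd_tac.
apply: exec_eq (exec_move _ _) _; first by apply/eqP => e; exact: at_.
by move=> x; rewrite /S; upd_tac.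
Qed.

(* The registers from [b] on are scratch space, zero before and after. *)
Definition implements n (f : pfun n) (c : cmd) (ins : n.-tuple nat)
    (out b : nat) : Prop :=
  forall s y, (forall r, b <= r -> s r = 0) -> s out = 0 ->
    f (map_tuple s ins) y -> exec c s (upd s out y).

(** All placements of inputs, output and scratch space are allowed, so that the closure proofs can
    allocate the registers of subprograms freely. *)
Definition implementable n (f : pfun n) : Prop :=
  forall (ins : n.-tuple nat) out b,
    (forall r, r \in val ins -> r < b) -> out < b -> out \notin val ins ->
    exists c, implements f c ins out b.

Lemma map_tuple_ext n (s s' : regs) (ins : n.-tuple nat) :
  (forall r, r \in val ins -> s r = s' r) -> map_tuple s ins = map_tuple s' ins.
Proof. by move=> e; apply/val_inj/eq_in_map. Qed.

Lemma implementable_proj n (i : 'I_n) :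
  implementable (fun x y => y = tnth x i).
Proof.
move=> ins out b lt lto nin; exists (copy (tnth ins i) out b) => s y s0 o0 ->.
have a_in : tnth ins i \in val ins by exact: mem_tnth.
have ltb := lt _ a_in.
apply: exec_eq (exec_copy _ _ _ _) _.
- by apply: contraNneq nin => <-.
- by apply/eqP; lia.
- by apply/eqP; lia.
- exact: s0.
- by move=> x; rewrite tnth_map o0.
Qed.

Lemma implementable_succ : @implementable 1 (fun x y => y = (thead x).+1).
Proof.
move=> ins out b lt lto nin.
have [c cP] := @implementable_proj 1 ord0 ins out b lt lto nin.
exists (Seq c (Inc out)) => s y s0 o0 ->.
apply: exec_eq (exec_seq (cP _ _ s0 o0 erefl) (exec_inc _ _)) _ => x.
by rewrite /thead; upd_tac.
Qed.

Lemma clear_range b k :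
  exists c, forall s, exec c s (fun r => if b <= r < b + k then 0 else s r).
Proof.
elim: k => [|k [c IH]].
  exists Skip => s; apply: exec_eq (exec_skip _) _ => r.
  by case: ifP => //; lia.
exists (Seq c (clear (b + k))) => s.
apply: exec_eq (exec_seq (IH _) (exec_clear _ _)) _ => r.
by rewrite /upd; case: eqP => [->|ne]; [case: ifP; lia|];
  case: ifP; case: ifP => //; lia.
Qed.

Lemma implementable_comp n k (f : pfun k) (g : 'I_k -> pfun n) :
  implementable f -> (forall i, implementable (g i)) ->
  implementable (pf_comp f g).
Proof.
move=> If Ig ins out b lt lto nin.
(* The value of [g i] is stored in register [b + i]. The scratch space of every [g i] starts at
   [b + k], above all these results. *)
have G j : j <= k -> exists c, forall s (w : k.-tuple nat),
    (forall r, b <= r -> s r = 0) ->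
    (forall i, g i (map_tuple s ins) (tnth w i)) ->
    exec c s (fun r => if b <= r < b + j then nth 0 w (r - b) else s r).
  elim: j => [_|j IH jk].
    exists Skip => s w _ _; apply: exec_eq (exec_skip _) _ => r.
    by case: ifP => //; lia.
  have [c cP] := IH (ltnW jk).
  have [|||d dP] := Ig (Ordinal jk) ins (b + j) (b + k).
  - by move=> r /lt; lia.
  - by lia.
  - by apply/negP => /lt; lia.
  exists (Seq c d) => s w s0 gw.
  apply: exec_eq (exec_seq (cP _ _ s0 gw) (dP _ (nth 0 w j) _ _ _)) _.
  - by move=> r br; case: ifP; rewrite ?s0 //; lia.
  - by case: ifP; rewrite ?s0 //; lia.
  - have := gw (Ordinal jk); rewrite (tnth_nth 0) /=.
    rewrite (@map_tuple_ext _ s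
      (fun r => if b <= r < b + j then nth 0 w (r - b) else s r)) //.
    by move=> r /lt rb; case: ifP => //; lia.
  - move=> r; rewrite /upd; case: eqP => [->|ne].
      by rewrite addKn ifT //; lia.
    by case: ifP; case: ifP => //; lia.
have [c cP] := G k (leqnn k).
have [|||d dP] := If [tuple b + i | i < k] out (b + k).
- by move=> r /mapP[i _ ->]; have := ltn_ord i; lia.
- by lia.
- by apply/negP => /mapP[i _]; have := ltn_ord i; lia.
have [e eP] := clear_range b k.
exists (Seq c (Seq d e)) => s y s0 o0 [w [gw fw]].
apply: exec_eq (exec_seq (cP _ _ s0 gw) (exec_seq (dP _ y _ _ _) (eP _))) _.
- by move=> r br; case: ifP; rewrite ?s0 //; lia.
- by case: ifP => //; lia.
- suff -> : map_tuple (fun r => if b <= r < b + k then nth 0 w (r - b) else s r)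
     [tuple b + i | i < k] = w by [].
  apply: eq_from_tnth => i; rewrite tnth_map tnth_mktuple addKn -tnth_nth.
  by rewrite ifT //; have := ltn_ord i; lia.
- move=> r; rewrite /upd; case: eqP => [->|ne]; case: ifP => //; try lia.
    by move=> /andP[br _]; rewrite s0.
  by move=> ->.
Qed.

(** The intermediate values are collected in one sequence, from which the states required by
    [exec_loop_iter] are built. *)
Lemma pf_prec_at_seq n (f : pfun n) (g : pfun n.+2) k x y :
  pf_prec_at f g k x y -> exists Z : nat -> nat,
    [/\ f x (Z 0), Z k = y &
        forall j, j < k -> g (cons_tuple j (cons_tuple (Z j) x)) (Z j.+1)].
Proof.
elim: k y => [y fy|k IH y [z [/IH[Z [Z0 Zk ZS]] gz]]] /=.
  by exists (fun=> y).
exists (upd Z k.+1 y); split; [by []|by upd_tac|move=> j jk].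
rewrite /upd ltn_eqF // eqSS; case: eqP => [->|ne]; first by rewrite Zk.
by apply: ZS; lia.
Qed.

Lemma implementable_prec n (f : pfun n) (g : pfun n.+2) :
  implementable f -> implementable g -> implementable (pf_prec f g).
Proof.
move=> If Ig ins out b; case/tupleP: ins => a ins lt lto nin.
have lta : a < b by apply: lt; rewrite /= mem_head.
have lti r : r \in val ins -> r < b.
  by move=> ri; apply: lt; rewrite /= inE ri orbT.
(* Register [b] holds the index of the round (after serving as scratch for the initial copy), [b.+1]
   the current value, [b.+2] the next value, and [b.+3] the number of rounds left. *)
have [|||c cP] := If ins b.+1 (b + 4).
- by move=> r /lti; lia.
- by lia.
- by apply/negP => /lti; lia.
have [|||d dP] := Ig [tuple of [:: b, b.+1 & ins]] b.+2 (b + 4).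
- by move=> r; rewrite /= !inE => /or3P[/eqP->|/eqP->|/lti]; lia.
- by lia.
- by rewrite /= !inE; apply/negP => /or3P[/eqP|/eqP|/lti]; lia.
exists (Seq (copy a b.+3 b) (Seq c (Seq
  (Loop b.+3 (Seq d (Seq (clear b.+1) (Seq (move b.+2 b.+1) (Inc b)))))
  (Seq (move b.+1 out) (clear b))))) => s y s0 o0.
rewrite /pf_prec.
have -> : thead (map_tuple s [tuple of a :: ins]) = s a.
  by rewrite /thead tnth_map.
have -> : behead_tuple (map_tuple s [tuple of a :: ins]) = map_tuple s ins.
  by apply/val_inj.
move=> /pf_prec_at_seq[Z [Z0 Zk ZS]].
have nin_a : out != a by apply: contraNneq nin => ->; rewrite /= mem_head.
pose S j := upd (upd (upd s b.+3 (s a - j)) b.+1 (Z j)) b j.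
have x_ext (s' : regs) : (forall r, r < b -> s' r = s r) ->
    map_tuple s' ins = map_tuple s ins.
  by move=> e; apply: map_tuple_ext => r /lti /e.
have sb j : b <= j -> s j = 0 by exact: s0.
apply: (@exec_seq _ _ _ (upd s b.+3 (s a))).
  apply: exec_eq (exec_copy _ _ _ _) _; try (by apply/eqP; lia).
    by rewrite sb.
  by move=> r; rewrite sb //; lia.
apply: (@exec_seq _ _ _ (S 0)).
  apply: exec_eq (cP _ (Z 0) _ _ _) _.
  - by move=> r br; rewrite /upd; case: eqP => [|_]; [lia|apply: sb; lia].
  - by rewrite /upd; case: eqP => [|_]; [lia|apply: sb; lia].
  - by rewrite x_ext // => r rb; rewrite /upd; case: eqP => //; lia.
  - move=> r; rewrite /S subn0; upd_tac; exact: sb.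
apply: (@exec_seq _ _ _ (S (s a))).
  apply: (@exec_loop_iter _ _ (s a) S) => //; first by rewrite /S; upd_tac.
  move=> j jk; split; first by rewrite /S; upd_tac.
  apply: (@exec_seq _ _ _ (upd (upd (S j) b.+3 (s a - j).-1) b.+2 (Z j.+1))).
    apply: dP.
    - move=> r br; rewrite /S /upd; do !(case: eqP => [|_]; first lia).
      by apply: sb; lia.
    - rewrite /S /upd; do !(case: eqP => [|_]; first lia).
      by apply: sb; lia.
    - move: (ZS _ jk); congr g; apply/val_inj => /=; congr [:: _, _ & _].
      + by rewrite /S; upd_tac.
      + by rewrite /S; upd_tac.
      + apply/esym/eq_in_map => r /lti rb; rewrite /S /upd.
        by do !(case: eqP => [|_]; first lia).
  apply: exec_eq (exec_seq (exec_clear _ _)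
    (exec_seq (exec_move _ _) (exec_inc _ _))) _; first by apply/eqP; lia.
  move=> r; rewrite /S; upd_tac; rewrite ?sb //; lia.
apply: exec_eq (exec_seq (exec_move _ _) (exec_clear _ _)) _.
  by apply/eqP; lia.
move=> r; rewrite -Zk /S; upd_tac; rewrite ?subnn ?sb //; lia.
Qed.

Lemma implementable_mu n (f : pfun n.+1) :
  implementable f -> implementable (pf_mu f).
Proof.
move=> If ins out b lt lto nin.
(* Register [b] holds the candidate and [b.+1] the value of [f] there, on which the search loop
   tests. *)
have [|||c cP] := If [tuple of b :: ins] b.+1 (b + 2).
- by move=> r; rewrite /= inE => /orP[/eqP->|/lt]; lia.
- by lia.
- by rewrite /= inE; apply/negP => /orP[/eqP|/lt]; lia.
exists (Seq c
  (Seq (Loop b.+1 (Seq (clear b.+1) (Seq (Inc b) c))) (move b out))).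
move=> s y s0 o0 [fy fz].
have sb j : b <= j -> s j = 0 by exact: s0.
pose S z v := upd (upd s b z) b.+1 v.
have runc z v : f (cons_tuple z (map_tuple s ins)) v -> exec c (S z 0) (S z v).
  move=> fv; apply: exec_eq (cP _ v _ _ _) _.
  - move=> r br; rewrite /S /upd; do !(case: eqP => [|_]; first lia).
    by apply: sb; lia.
  - by rewrite /S; upd_tac.
  - move: fv; congr f; apply/val_inj => /=; congr cons.
      by rewrite /S; upd_tac.
    apply/esym/eq_in_map => r /lt rb; rewrite /S /upd.
    by do !(case: eqP => [|_]; first lia).
  - by move=> r; rewrite /S; upd_tac.
(* Induction backwards from the least zero [y]: the loop entered at candidate [y - d] ends at [y].
   The value [v] is existential because [f] is only a relation. *)
have L d : d <= y -> exists2 v, f (cons_tuple (y - d) (map_tuple s ins)) v &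
    exec (Loop b.+1 (Seq (clear b.+1) (Seq (Inc b) c))) (S (y - d) v) (S y 0).
  elim: d => [_|d IH dy].
    by exists 0; rewrite subn0 //; apply: exec_loop0; rewrite /S; upd_tac.
  have [v fv ex] := IH (ltnW dy).
  have [|t ft] := fz (y - d.+1); first by lia.
  exists t.+1 => //; apply: exec_loopS ex; first by rewrite /S; upd_tac.
  apply: (@exec_seq _ _ _ (S (y - d.+1) 0)).
    by apply: exec_eq (exec_clear _ _) _ => r; rewrite /S; upd_tac.
  apply: exec_seq (runc _ _ fv).
  by apply: exec_eq (exec_inc _ _) _ => r; rewrite /S; upd_tac.
have [v] := L y (leqnn y); rewrite subnn => fv ex.
apply: (@exec_seq _ _ _ (S 0 v)).
  have E : s = S 0 0.
    apply/funext => r; rewrite /S; upd_tac; rewrite sb //; lia.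
  by rewrite {1}E; apply: runc.
apply: exec_seq ex _.
apply: exec_eq (exec_move _ _) _; first by apply/eqP; lia.
move=> r; rewrite /S; upd_tac; rewrite ?sb //; lia.
Qed.

Lemma partial_recursive_implementable n (f : pfun n) :
  partial_recursive f -> implementable f.
Proof.
elim=> {n f} [n|||n k f g _ If _ Ig|n f g _ If _ Ig|n f _ If].
- move=> ins out b _ _ _; exists Skip => s y _ o0 ->.
  by apply: exec_eq (exec_skip _) _ => r; upd_tac.
- exact: implementable_succ.
- exact: implementable_proj.
- exact: implementable_comp.
- exact: implementable_prec.
- exact: implementable_mu.
Qed.

(** * Total recursive functions *)

Definition total_recursive n (F : n.-tuple nat -> nat) : Prop :=
  partial_recursive (fun x y => y = F x).

Lemma total_recursive_ext n (F G : n.-tuple nat -> nat) :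
  F =1 G -> total_recursive F -> total_recursive G.
Proof. by move=> /funext->. Qed.

(** The arguments being total functions, the intermediate tuple in [pf_comp] is determined and can
    be eliminated. *)
Lemma partial_recursive_comp n k (f : pfun k)
    (G : 'I_k -> n.-tuple nat -> nat) :
  partial_recursive f -> (forall i, total_recursive (G i)) ->
  partial_recursive (fun x y => f [tuple G i x | i < k] y).
Proof.
move=> rf rG; suff <- : pf_comp f (fun i x y => y = G i x) =
    (fun x y => f [tuple G i x | i < k] y) by exact: PR_comp.
apply/funext => x; apply/funext => y; apply/propext; split.
  move=> [w [wG fw]]; suff -> : [tuple G i x | i < k] = w by [].
  by apply: eq_from_tnth => i; rewrite tnth_mktuple wG.
by exists [tuple G i x | i < k]; split=> // i; rewrite tnth_mktuple.
Qed.

Lemma total_recursive_arg n (i : 'I_n) :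
  total_recursive (fun x : n.-tuple nat => nth 0 x i).
Proof.
by apply: total_recursive_ext (PR_proj i) => x; rewrite (tnth_nth 0).
Qed.

Lemma total_recursive_app1 n (F : nat -> nat) (G : n.-tuple nat -> nat) :
  total_recursive (fun x : 1.-tuple nat => F (nth 0 x 0)) ->
  total_recursive G ->
  total_recursive (fun x => F (G x)).
Proof.
move=> rF rG; have := @partial_recursive_comp n 1 _ (fun=> G) rF (fun=> rG).
congr partial_recursive; apply/funext => x.
by rewrite -[0]/(val (@ord0 0)) -tnth_nth tnth_mktuple.
Qed.

Lemma total_recursive_app2 n (F : nat -> nat -> nat)
    (G H : n.-tuple nat -> nat) :
  total_recursive (fun x : 2.-tuple nat => F (nth 0 x 0) (nth 0 x 1)) ->
  total_recursive G -> total_recursive H ->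
  total_recursive (fun x => F (G x) (H x)).
Proof.
move=> rF rG rH.
have := @partial_recursive_comp n 2 _ (fun i => if i == ord0 then G else H) rF.
have -> : (fun (x : n.-tuple nat) y =>
   y = F (nth 0 [tuple (if i == ord0 then G else H) x | i < 2] 0)
         (nth 0 [tuple (if i == ord0 then G else H) x | i < 2] 1)) =
   (fun x y => y = F (G x) (H x)).
  apply/funext => x; rewrite -[0]/(val (@ord0 1)) -[1]/(val (@ord_max 1)).
  by rewrite -!tnth_nth !tnth_mktuple.
by apply=> i; case: ifP.
Qed.

Lemma total_recursive_succ n (G : n.-tuple nat -> nat) :
  total_recursive G -> total_recursive (fun x => (G x).+1).
Proof.
apply: (total_recursive_app1 (F := succn)).
by apply: total_recursive_ext PR_succ => x; rewrite /thead (tnth_nth 0).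
Qed.

Lemma total_recursive_cst n c : total_recursive (fun _ : n.-tuple nat => c).
Proof. by elim: c => [|c IH]; [exact: PR_zero|exact: total_recursive_succ]. Qed.

Lemma total_recursive_prec n (F : n.-tuple nat -> nat)
    (G : n.+2.-tuple nat -> nat) (H : n.+1.-tuple nat -> nat) :
  total_recursive F -> total_recursive G ->
  (forall x, H (cons_tuple 0 x) = F x) ->
  (forall k x, H (cons_tuple k.+1 x) =
               G (cons_tuple k (cons_tuple (H (cons_tuple k x)) x))) ->
  total_recursive H.
Proof.
move=> rF rG H0 HS; have := PR_prec rF rG; congr partial_recursive.
apply/funext => x; apply/funext => y; case/tupleP: x => k x.
rewrite /pf_prec theadE.
have -> : behead_tuple [tuple of k :: x] = x by apply/val_inj.
have -> : H [tuple of k :: x] = H (cons_tuple k x).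
  by congr H; apply/val_inj.
elim: k y => [|k IH] y /=; first by rewrite H0.
apply/propext; split=> [[z []]|->]; first by rewrite IH HS => -> ->.
by exists (H (cons_tuple k x)); rewrite IH HS.
Qed.

Lemma total_recursive_add n (G H : n.-tuple nat -> nat) :
  total_recursive G -> total_recursive H ->
  total_recursive (fun x => G x + H x).
Proof.
apply: total_recursive_app2.
apply: (@total_recursive_prec 1 (fun x => nth 0 x 0) (fun x => (nth 0 x 1).+1)).
- exact: (total_recursive_arg (@ord0 0)).
- exact/total_recursive_succ/(total_recursive_arg (@Ordinal 3 1 isT)).
- by [].
- by [].
Qed.

Lemma total_recursive_mul n (G H : n.-tuple nat -> nat) :
  total_recursive G -> total_recursive H ->
  total_recursive (fun x => G x * H x).
Proof.
apply: total_recursive_app2.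
apply: (@total_recursive_prec 1 (fun=> 0) (fun x => nth 0 x 2 + nth 0 x 1)).
- exact: total_recursive_cst.
- apply: total_recursive_add.
    exact: (total_recursive_arg (@Ordinal 3 2 isT)).
  exact: (total_recursive_arg (@Ordinal 3 1 isT)).
- by [].
- by move=> k x /=; rewrite mulSn.
Qed.

Lemma total_recursive_exp2 n (G : n.-tuple nat -> nat) :
  total_recursive G -> total_recursive (fun x => 2 ^ G x).
Proof.
apply: (total_recursive_app1 (F := expn 2)).
apply: (@total_recursive_prec 0 (fun=> 1) (fun x => nth 0 x 1 + nth 0 x 1)).
- exact: total_recursive_cst.
- by apply: total_recursive_add; exact: (total_recursive_arg (@Ordinal 2 1 isT)).
- by [].
- by move=> k x /=; rewrite expnS mul2n addnn.
Qed.

Lemma total_recursive_code_cons n (G : n.-tuple nat -> nat)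
    (L : n.-tuple nat -> seq nat) :
  total_recursive G -> total_recursive (fun x => CodeSeq.code (L x)) ->
  total_recursive (fun x => CodeSeq.code (G x :: L x)).
Proof.
move=> rG rL.
apply: (@total_recursive_ext _ (fun x =>
  2 ^ G x * (CodeSeq.code (L x) + CodeSeq.code (L x)).+1)).
  by move=> x /=; rewrite addnn.
apply: total_recursive_mul; first exact: total_recursive_exp2.
exact/total_recursive_succ/total_recursive_add.
Qed.

(** * The code of an instance as a function of its valuation *)

(** Under [code_int], the numerator [k] becomes [k.*2] and the denominator 1 becomes 2. *)
Definition code_nat (k : nat) : nat := CodeSeq.code [:: k.*2; 2].

Lemma code_rat_nat (k : nat) : code_rat (k%:R)%R = code_nat k.
Proof.
by rewrite /code_rat pmulrn numq_int denq_int.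
Qed.

Definition code_inputs (K C : nat) : nat :=
  CodeSeq.code [:: code_nat K; code_nat C; code_nat 0; code_nat 0; code_nat 0].

(** Prepending [x] acts on codes as the affine map sending [c] to [2 ^ x * (2 * c + 1)], and affine
    maps compose. *)
Lemma code_affine (s : seq nat) :
  exists a b, forall t, CodeSeq.code (s ++ t) = a + b * CodeSeq.code t.
Proof.
elim: s => [|x s [a [b IH]]]; first by exists 0, 1 => t; rewrite mul1n.
exists (2 ^ x * a.*2.+1), (2 ^ x * b.*2) => t.
by rewrite /= IH -mulnA -mulnDr; congr (_ * _); lia.
Qed.

(** When [K] and [C] are the affine coefficients contributed by the fixed part of an instance, this
    is the code of that instance with inputs [K] and [C]. *)
Definition self_code (K C : nat) : nat :=
  K + C * CodeSeq.code [:: code_inputs K C].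

Lemma total_recursive_self_code : total_recursive
  (fun x : 2.-tuple nat => self_code (nth 0 x 0) (nth 0 x 1)).
Proof.
have r0 := total_recursive_arg (@ord0 1).
have r1 := total_recursive_arg (@ord_max 1).
have rn n (G : n.-tuple nat -> nat) : total_recursive G ->
    total_recursive (fun x => code_nat (G x)).
  move=> rG; apply: total_recursive_code_cons; last exact: total_recursive_cst.
  apply: (@total_recursive_ext _ (fun x => G x + G x)).
    by move=> x; rewrite addnn.
  exact: total_recursive_add.
rewrite /self_code; apply: total_recursive_add; first exact: r0.
apply: total_recursive_mul; first exact: r1.
apply: total_recursive_code_cons; last exact: total_recursive_cst.
apply: total_recursive_code_cons; first exact: rn.
apply: total_recursive_code_cons; first exact: rn.
exact: total_recursive_cst.
Qed.

Import Order.TTheory GRing.Theory Num.Theory.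

(** * Automata over arbitrary location types, in absolute time *)

Section Transport.
Local Open Scope ring_scope.
Variables (R : realType) (T : eqType) (P : finType) (N : nat).
Local Notation operand := (P + int)%type.
Definition xedge : Type := (T * guard nat operand * nat * T)%type.
Implicit Types (E : seq xedge) (rv : operand -> R).

(* A clock is represented by the date of its last reset: at date [t], the clock
   [x] has value [t - last x]. *)
Definition holds rv (t : R) (last : nat -> R) (g : guard nat operand) : bool :=
  all (fun c => cmp_rel c.1.2 (t - last c.1.1) (rv c.2)) g.

Fixpoint trun E rv (l : T) (t : R) (last : nat -> R) (w : seq nat) : Prop :=
  match w with
  | [::] => True
  | a :: w' => exists t' g l',
      [/\ t <= t', (l, g, a, l') \in E, holds rv t' last g &
          trun E rv l' t' (upd last a t') w']
  end.

Lemma trun_prefix E rv l t last w1 w2 :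
  trun E rv l t last (w1 ++ w2) -> trun E rv l t last w1.
Proof.
elim: w1 l t last => //= a w1 IH l t last [t' [g [l' [tt' lE hg /IH r]]]].
by exists t', g, l'.
Qed.

Definition letters_below (E : seq xedge) : Prop :=
  forall l g a l', (l, g, a, l') \in E ->
    (a < N.+1)%N /\ all (fun c => (c.1.1 < N.+1)%N) g.

Variables (E : seq xedge) (l0 : T).
Hypothesis ltE : letters_below E.

Definition locations : seq T := l0 :: flatten [seq [:: e.1.1.1; e.2] | e <- E].

(** Unlisted locations all go to the last index, which no listed one has; hence injectivity needs
    only one listed argument. *)
Definition enc (l : T) : 'I_(size locations).+1 := inord (index l locations).

Lemma enc_inj l l' : l \in locations -> enc l = enc l' -> l = l'.
Proof.
move=> lin /(congr1 val); rewrite /= !inordK ?ltnS ?index_size // => e.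
have l'in : l' \in locations by rewrite -index_mem -e index_mem.
by rewrite -(nth_index l0 lin) e nth_index.
Qed.

Definition enc_guard (g : guard nat operand) : guard 'I_N.+1 operand :=
  [seq (inord c.1.1, c.1.2, c.2) | c <- g].

Definition enc_edge (e : xedge) : edge 'I_N.+1 'I_(size locations).+1 operand :=
  let: (l, g, a, l') := e in (enc l, enc_guard g, inord a, enc l').

Definition enc_pera : pera 'I_N.+1 'I_(size locations).+1 P :=
  Automaton (enc l0) [ffun=> [::]] [seq enc_edge e | e <- E].

Variable v : param_valuation P.
Let rv (k : operand) : R := ratr (inst_operand v k).
Let A := inst v enc_pera.

Lemma edge_locations l g a l' : (l, g, a, l') \in E ->
  l \in locations /\ l' \in locations.
Proof.
by move=> lE; split; rewrite inE; apply/orP; right; apply/flattenP;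
  exists [:: l; l']; rewrite ?inE ?eqxx ?orbT //; apply/mapP;
  exists (l, g, a, l').
Qed.

Lemma inst_is_state (s : config R 'I_N.+1 'I_(size locations).+1) :
  is_state A s.
Proof. by rewrite /is_state /A /inst /= !ffunE. Qed.

Definition clocks_of (mu : clock_valuation R 'I_N.+1) (t : R)
    (last : nat -> R) : Prop := forall x, (mu x)%:num = t - last (val x).

Lemma satisfies_holds mu t last g : clocks_of mu t last ->
  all (fun c => (c.1.1 < N.+1)%N) g ->
  satisfies mu (inst_guard v (enc_guard g)) = holds rv t last g.
Proof.
move=> Hmu; elim: g => //= -[[x o] k] g IH /= /andP[xN /IH <-].
by rewrite Hmu /= inordK.
Qed.

Lemma clocks_of_elapse mu t last d t' : clocks_of mu t last ->
  t' = t + d%:num -> clocks_of (elapse mu d) t' last.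
Proof. by move=> Hmu -> x; rewrite ffunE /= Hmu; lra. Qed.

Lemma clocks_of_reset mu t last a : clocks_of mu t last -> (a < N.+1)%N ->
  clocks_of (reset mu (inord a)) t (upd last a t).
Proof.
move=> Hmu aN x; rewrite ffunE /upd -val_eqE /= inordK //.
by case: eqP => _ /=; rewrite ?subrr // Hmu.
Qed.

(** A delay is the difference of consecutive dates. The invariants are empty, so every delay is
    possible. *)
Lemma run_from_trun l mu t last w : l \in locations -> clocks_of mu t last ->
  (exists2 r, run_from A (enc l, mu) r & w = untimed_word r) <->
  trun E rv l t last (map val w).
Proof.
elim: w l mu t last => [|a w IH] l mu t last lin Hmu.
  by split=> // _; exists [::].
split=> [[[|[d e] r] //= [s1 [s2 [[-> _] ds rr]]] [ea ew]]|].
  case: e ds ea => [[[k h] b] k'] /=.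
  case=> _ /mapP[e0 /mapP[[[[l1 g] b0] l2] lE ->]].
  case=> -> -> -> -> [el es2] er hs -> {k h b k'}.
  have [b0N gN] := ltE lE; have [l1in l2in] := edge_locations lE.
  have {}el := enc_inj lin el; rewrite -{}el {l1 l1in} in lE.
  have Hd := clocks_of_elapse Hmu (erefl (t + d%:num)).
  exists (t + d%:num), g, l2; split; rewrite ?inordK //.
  - by rewrite lerDl.
  - by rewrite -(satisfies_holds Hd).
  - apply/(IH l2 (reset (elapse mu d) (inord b0))) => //.
      exact: clocks_of_reset.
    by exists r => //; rewrite -er -es2; case: s2 rr {es2 er}.
move=> /= [t' [g [l' [tt' lE hg tr]]]].
have [aN gN] := ltE lE; have [_ l'in] := edge_locations lE.
have d0 : 0 <= t' - t by rewrite subr_ge0.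
have Hd : clocks_of (elapse mu (NngNum d0)) t' last.
  by apply: clocks_of_elapse Hmu _ => /=; lra.
have [|r rr ->] := (IH l' (reset (elapse mu (NngNum d0)) a) t' _ l'in _).2 tr.
  by have := clocks_of_reset Hd aN; rewrite inord_val.
exists ((NngNum d0, inst_edge v (enc_edge (l, g, val a, l'))) :: r).
  exists (enc l, elapse mu (NngNum d0)).
  exists (enc l', reset (elapse mu (NngNum d0)) a).
  split=> //; first by split=> // ? _; apply: inst_is_state.
  split; rewrite ?inord_val //.
  - by split; apply: inst_is_state.
  - apply/mapP; exists (enc_edge (l, g, val a, l')); first exact: map_f lE.
    by rewrite /= inord_val.
  - by rewrite (satisfies_holds Hd).
by rewrite /untimed_word /= inord_val.
Qed.

Lemma UL_trun w : UL R A w <-> trun E rv l0 0 (fun=> 0) (map val w).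
Proof.
have H := @run_from_trun l0 (zero_valuation R 'I_N.+1) 0 (fun=> 0) w.
have {}H := H (mem_head _ _) (fun x => _).
rewrite -H; last by move=> x; rewrite ffunE subr0.
split=> [[r [_ rr] ->]|[r rr ->]]; exists r => //.
by split=> //; apply: inst_is_state.
Qed.

End Transport.

Lemma UL_eq_trun (R : realType) (T : eqType) (P : finType) N
    (E : seq (xedge T P)) l0 (v v' : param_valuation P) :
  letters_below N E ->
  UL R (inst v' (enc_pera N E l0)) = UL R (inst v (enc_pera N E l0)) <->
  forall w, trun E (fun k => ratr (inst_operand v' k) : R) l0 0%R (fun=> 0%R) w <->
            trun E (fun k => ratr (inst_operand v k) : R) l0 0%R (fun=> 0%R) w.
Proof.
move=> ltE; split=> [eq w|eq]; last first.
  by apply/funext => w; apply/propext; rewrite !UL_trun.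
(* A word that can be read has only letters of the alphabet, hence is the image of a word over the
   ordinals. *)
have bnd (rv : P + int -> R) l t last : trun E rv l t last w ->
    w = map val (map (@inord N) w).
  elim: w l t last => //= a w IH l t last [t' [g [l' [_ /ltE[aN _] _ /IH <-]]]].
  by rewrite inordK.
split=> r; rewrite (bnd _ _ _ _ r).
  by rewrite -UL_trun // -eq UL_trun // -(bnd _ _ _ _ r).
by rewrite -UL_trun // eq UL_trun // -(bnd _ _ _ _ r).
Qed.

(** * The automaton of a counter machine *)

(* [pK] and [pC] hold the inputs of the machine; [pL], [pM] and [pH] are meant
   to be P - 1, P and P + 1. *)
Definition pK : 'I_5 := @Ordinal 5 0 isT.
Definition pC : 'I_5 := @Ordinal 5 1 isT.
Definition pL : 'I_5 := @Ordinal 5 2 isT.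
Definition pM : 'I_5 := @Ordinal 5 3 isT.
Definition pH : 'I_5 := @Ordinal 5 4 isT.

Local Notation operand := ('I_5 + int)%type.

Definition clock_eq (x : nat) (k : operand) : guard nat operand :=
  [:: (x, OpLe, k); (x, OpGe, k)].

(* One reading of the cyclic word either executes an operation ([inr]), or is
   one of four special kinds: check the relations between [pL], [pM] and [pH]
   (0), load the inputs (1), enter the free mode by checking that the period
   parameters are 0 (2), read freely (3). *)
Definition label := (nat + op)%type.
Definition macro := (nat * label * nat)%type.
Definition loc := (nat + macro * nat)%type.

Section Automaton.
Variables (n : nat) (mtr : seq transition) (lf : nat).

(* Letters [2 * i] and [2 * i + 1] belong to counter [i]; counter [n + 1] counts
   the cycles and the machine uses counters [0] to [n]. *)
Definition nletters := n.*2.+4.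
Local Notation m := nletters.
Definition cyc := iota 0 m.

(** The time between two resets of x_i. Since z_i is reset after exactly [pM], a shorter time widens
    the gap by one and a longer one narrows it. The cycle counter [n.+1] always grows. *)
Definition shift_param (o : op) (i : nat) : 'I_5 :=
  if i == n.+1 then pL else
  match o.1 with
  | KInc => if i == o.2 then pL else pM
  | KDec => if i == o.2 then pH else pM
  | _ => pM
  end.

Definition input_operand (i : nat) : operand :=
  match i with 0 => inl pK | 1 => inl pC | _ => inr 0%R end.

(** In kinds 0 and 2, taken from the start, a clock not yet reset shows the date. Kind 0 thus puts
    letters 0, 1, 2 at the dates [pL], [pM], [pH] and requires them one unit apart; kind 2 bounds
    the three parameters by a date that is at most 0. Kind 1 makes the gap of each counter equal to
    its input. *)
Definition macro_guard (lab : label) (j : nat) : guard nat operand :=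
  match lab with
  | inr o =>
      if odd j then
        clock_eq j (inl pM) ++
        (if (o.1 == KZero) && (j./2 == o.2) then [:: (j.-1, OpLe, inr 0%R)]
         else [::])
      else clock_eq j (inl (shift_param o j./2))
  | inl 0 =>
      match j with
      | 0 => clock_eq 1 (inl pL)
      | 1 => clock_eq 1 (inl pM) ++ clock_eq 0 (inr 1%R)
      | 2 => clock_eq 3 (inl pH) ++ clock_eq 1 (inr 1%R)
      | _ => [::]
      end
  | inl 1 => if odd j then clock_eq j.-1 (input_operand j./2) else [::]
  | inl 2 =>
      if j == 0 then [:: (1, OpGe, inl pL); (1, OpGe, inl pM);
                         (1, OpGe, inl pH); (1, OpLe, inr 0%R)] else [::]
  | inl _ => [::]
  end.

(* Locations 2, 3 and 4 are left to the pinning gadgets. *)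
Definition macro_list : seq macro :=
  [:: (0, inl 0, 1), (1, inl 1, 5), (0, inl 2, lf + 5),
      (lf + 5, inl 3, lf + 5) &
      [seq (x.1.1 + 5, inr x.1.2, x.2 + 5) | x <- mtr]].

Local Notation macros := macro_list.

Definition macro_loc (tr : macro) (j : nat) : loc :=
  if j == 0 then inl tr.1.1 else inr (tr, j).

Definition macro_edge (tr : macro) (j : nat) : xedge loc 'I_5 :=
  (macro_loc tr j, macro_guard tr.1.2 j, j,
   if j.+1 == m then inl tr.2 else inr (tr, j.+1)).

(** The last guard forbids any delay after the final letter 3, so that [q] is compared with a whole
    number of time units. *)
Definition pin_edges (a l : nat) (q : 'I_5) : seq (xedge loc 'I_5) :=
  [:: (inl 0, [:: (0, OpLe, inr 0%R)], a, inl l);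
      (inl l, clock_eq 3 (inr 1%R), 3, inl l);
      (inl l, clock_eq 0 (inl q) ++ [:: (3, OpLe, inr 0%R)], 0, inl 4)].

Definition auto_edges : seq (xedge loc 'I_5) :=
  [seq macro_edge tr j | tr <- macros, j <- cyc] ++
  pin_edges 1 2 pK ++ pin_edges 2 3 pC.

Lemma macro_guard_below lab j :
  j < m -> all (fun c => c.1.1 < m) (macro_guard lab j).
Proof.
rewrite /nletters; case: lab => [[|[|[|s]]]|o] /=; first by case: j => [|[|[|j]]].
- by case: ifP => // _ /=; lia.
- by case: ifP.
- by [].
- by case: ifP => _; rewrite ?all_cat /=; [case: ifP => _ /=|]; lia.
Qed.

Lemma pin_edgesP a l q e : e \in pin_edges a l q ->
  [\/ e = (inl 0, [:: (0, OpLe, inr 0%R)], a, inl l),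
      e = (inl l, clock_eq 3 (inr 1%R), 3, inl l) |
      e = (inl l, clock_eq 0 (inl q) ++ [:: (3, OpLe, inr 0%R)], 0, inl 4)].
Proof.
rewrite /pin_edges in_cons in_cons mem_seq1 => /or3P[] /eqP ->.
- by constructor 1.
- by constructor 2.
- by constructor 3.
Qed.

Lemma auto_edges_below : letters_below n.*2.+3 auto_edges.
Proof.
move=> l g a l'; rewrite mem_cat => /orP[/allpairsP[[tr j] [_ /=]]|].
  rewrite mem_iota => /andP[_ jm] [_ -> -> _]; split=> //.
  exact: macro_guard_below.
by rewrite mem_cat => /orP[] /pin_edgesP[] [_ -> -> _].
Qed.

Lemma macro_src tr :
  tr \in macros -> [|| tr.1.1 == 0, tr.1.1 == 1 | 4 < tr.1.1].
Proof.
rewrite !inE => /or4P[/eqP->|/eqP->|/eqP->|/orP[/eqP->|/mapP[x _ ->]]] //=; lia.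
Qed.

Lemma macro_dst tr : tr \in macros -> (tr.2 == 1) || (4 < tr.2).
Proof.
rewrite !inE => /or4P[/eqP->|/eqP->|/eqP->|/orP[/eqP->|/mapP[x _ ->]]] //=; lia.
Qed.

Lemma auto_edgesP l g a l' : (l, g, a, l') \in auto_edges ->
  (exists tr, [/\ tr \in macros, a < m & (l, g, a, l') = macro_edge tr a]) \/
  (l, g, a, l') \in pin_edges 1 2 pK ++ pin_edges 2 3 pC.
Proof.
rewrite mem_cat => /orP[/allpairsP[[tr j] /= [tin jin e]]|]; last by right.
left; exists tr; case: e jin => -> -> -> ->.
by rewrite mem_iota => /andP[_ jm].
Qed.

Lemma macro_edge_in tr j :
  tr \in macros -> j < m -> macro_edge tr j \in auto_edges.
Proof.
move=> tin jm; rewrite mem_cat; apply/orP; left; apply/allpairsP.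
by exists (tr, j); split=> //; rewrite mem_iota.
Qed.

(** * Runs over one cycle *)

Local Open Scope ring_scope.
Variable R : realType.
Implicit Types (rv : operand -> R) (last : nat -> R).

Lemma holds_clock_eq rv t last x k :
  holds rv t last (clock_eq x k) = (t - last x == rv k).
Proof. by rewrite /holds /= andbT eq_le. Qed.

Lemma holds_cat rv t last g h :
  holds rv t last (g ++ h) = holds rv t last g && holds rv t last h.
Proof. exact: all_cat. Qed.

Local Notation run rv := (trun auto_edges rv).

(* The dates of one reading of [cyc] are those recorded by the last resets. *)
Definition cycle_run rv (lab : label) (t : R) (last last' : nat -> R) : Prop :=
  [/\ t <= last' 0%N,
      forall j, (j.+1 < m)%N -> last' j <= last' j.+1,
      forall j, (m <= j)%N -> last' j = last j &
      forall j, (j < m)%N ->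
        holds rv (last' j) (fun c => if (c < j)%N then last' c else last c)
          (macro_guard lab j)].

Lemma cycle_intro rv s lab s' t last last' w : (s, lab, s') \in macros ->
  cycle_run rv lab t last last' -> run rv (inl s') (last' m.-1) last' w ->
  run rv (inl s) t last (cyc ++ w).
Proof.
move=> tin [t0 mono out hg] rw.
(* The dates of the last resets once [j] letters of the cycle have been read. *)
pose mix j c := if (c < j)%N then last' c else last c.
suff H d j : (j + d = m)%N ->
    run rv (if j == m then inl s' else macro_loc (s, lab, s') j)
      (if j == 0%N then t else last' j.-1) (mix j) (iota j d ++ w).
  exact: (H m 0%N erefl).
elim: d j => [|d IH] j jd.
  have -> : j = m by lia.
  rewrite eqxx /=; have -> // : mix m = last'.
  apply/funext => c; rewrite /mix; case: ifP => // cm; rewrite out //; lia.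
have jm : (j < m)%N by lia.
rewrite ltn_eqF //; exists (last' j), (macro_guard lab j),
  (if j.+1 == m then inl s' else inr (s, lab, s', j.+1)); split.
- by case: j jm {jd} => [|j] jm //=; apply: mono.
- exact: (macro_edge_in tin jm).
- exact: hg.
- have := IH j.+1; rewrite addSnnS => /(_ jd).
  have -> // : mix j.+1 = upd (mix j) j (last' j).
  apply/funext => c; rewrite /mix /upd ltnS leq_eqVlt.
  by case: eqP => [->|].
Qed.

(** Only 2 and 3 need excluding: a gadget reads the letter 0 there, whereas it leaves location 0 by
    the letters 1 and 2 and has no edge out of location 4. *)
Lemma cycle_elim rv s t last w : s != 2 -> s != 3 ->
  run rv (inl s) t last (cyc ++ w) ->
  exists lab s' last', [/\ (s, lab, s') \in macros,
    cycle_run rv lab t last last' & run rv (inl s') (last' m.-1) last' w].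
Proof.
move=> s2 s3; have -> : cyc ++ w = 0%N :: (iota 1 m.-1 ++ w) by [].
move=> -[t' [g [l' [tt' /auto_edgesP[[tr [tin am E]]|]]]]]; last first.
  rewrite mem_cat => /orP[] /pin_edgesP[] [] // e.
    by rewrite e in s2.
  by rewrite e in s3.
case: tr tin E => [[s0 lab] s'] tin [es eg el']; rewrite -{}es in tin el'.
move=> hg rr; exists lab, s'.
(* Induction on the number [d] of letters left after letter [j], whose edge is already chosen; from
   then on the location records the macro. *)
suff H d j t0 last0 : (j + d.+1 = m)%N ->
    (exists t1, [/\ t0 <= t1, holds rv t1 last0 (macro_guard lab j) &
       run rv (if j.+1 == m then inl s' else inr (s, lab, s', j.+1)) t1
         (upd last0 j t1) (iota j.+1 d ++ w)]) ->
    exists last', [/\ t0 <= last' j,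
      forall i, (j <= i)%N -> (i.+1 < m)%N -> last' i <= last' i.+1,
      forall i, (i < j)%N || (m <= i)%N -> last' i = last0 i,
      forall i, (j <= i < m)%N -> holds rv (last' i)
        (fun c => if (c < i)%N then last' c else last0 c) (macro_guard lab i) &
      run rv (inl s') (last' m.-1) last' w].
  have [|last' [H0 H1 H2 H3 H4]] := H m.-1 0%N t last erefl.
    by exists t'; split=> //; [rewrite -eg|move: rr; rewrite el'].
  exists last'; split=> //; split=> // j jm; exact: H1.
elim: d j t0 last0 => [|d IH] j t0 last0 jd [t1 [t01 h1 r1]].
  exists (upd last0 j t1); have jm : j.+1 = m by lia.
  have low i : (i < j)%N || (m <= i)%N -> upd last0 j t1 i = last0 i.
    by rewrite /upd; case: eqP => //; lia.
  split=> //.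
  - by rewrite /upd eqxx.
  - by move=> i ji im; exfalso; lia.
  - move=> i jim; have -> : i = j by lia.
    rewrite {1}/upd eqxx; congr (holds rv _ _ _): h1.
    by apply/funext => c; case: ifP => // cj; rewrite low ?cj.
  - have -> : upd last0 j t1 m.-1 = t1 by rewrite -jm /upd eqxx.
    by move: r1; rewrite jm eqxx.
have jm : (j.+1 < m)%N by lia.
move: r1; rewrite ltn_eqF //= => -[t2 [g2 [l2 [t12 /auto_edgesP]]]].
case=> [[tr [_ _ E2]]|]; last first.
  by rewrite mem_cat => /orP[] /pin_edgesP[] [].
case: E2 => <- /= -> -> h2 r2.
have [||last' [H0 H1 H2 H3 H4]] := IH j.+1 t1 (upd last0 j t1); first by lia.
  by exists t2.
have lj : last' j = t1 by rewrite H2 ?ltnSn // /upd eqxx.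
have low i : (i < j)%N || (m <= i)%N -> last' i = last0 i.
  move=> hi; rewrite H2; last by clear -hi; lia.
  by rewrite /upd; case: eqP hi => // ->; rewrite ltnn leqNgt (ltnW jm).
exists last'; split=> //.
- by rewrite lj.
- move=> i; rewrite leq_eqVlt => /predU1P[<- _|ji im]; first by rewrite lj.
  exact: H1.
- move=> i /andP[]; rewrite leq_eqVlt => /predU1P[<- _|ji im].
    rewrite lj; congr (holds rv _ _ _): h1.
    by apply/funext => c; case: ifP => // cj; rewrite low ?cj.
  have {}H3 := H3 i; rewrite ji im in H3; have {}H3 := H3 isT.
  congr (holds rv _ _ _): H3; apply/funext => c; case: ifP => // ci.
  by rewrite /upd; case: eqP ci => // ->; rewrite ji.
Qed.

End Automaton.

(** * Free runs, pinning gadgets and comparison of languages *)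

Section Languages.
Variables (n : nat) (mtr : seq transition) (lf : nat) (R : realType).
Local Open Scope ring_scope.
Implicit Types (rv : operand -> R) (last : nat -> R).
Local Notation run rv := (trun (auto_edges n mtr lf) rv).
Local Notation macros := (macro_list mtr lf).
Local Notation m := (nletters n).
Local Notation cyc := (cyc n).

Definition cycles k := flatten (nseq k cyc).

(** The free macro has no guards, so all letters can be read at the date [t]. *)
Lemma free_run rv t last k : run rv (inl (lf + 5)%N) t last (cycles k).
Proof.
elim: k t last => [//|k IH] t last.
apply: (@cycle_intro _ _ _ _ _ _ (inl 3) (lf + 5)%N _ _
  (fun j => if (j < m)%N then t else last j)); last exact: IH.
  by rewrite !inE eqxx !orbT.
split=> //.
- by move=> j jm; rewrite jm (ltnW jm).
- by move=> j; rewrite leqNgt => /negbTE->.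
Qed.

Lemma start_free_run rv k :
  rv (inl pL) = 0 -> rv (inl pM) = 0 -> rv (inl pH) = 0 -> rv (inr 0) = 0 ->
  run rv (inl 0%N) 0 (fun=> 0) (cycles k).
Proof.
move=> L M H Z; case: k => [//|k].
apply: (@cycle_intro _ _ _ _ _ _ (inl 2) (lf + 5)%N _ _ (fun=> 0));
  last exact: free_run.
  by rewrite !inE eqxx !orbT.
split=> // j jm; rewrite /=; case: eqP => // ->.
by rewrite /holds /= L M H Z subr0 lexx.
Qed.

Fixpoint cyc_path (j : nat) (w : seq nat) : bool :=
  if w is a :: w' then (a == j) && cyc_path (if j.+1 == m then 0%N else j.+1) w'
  else true.

Lemma run_cyc_path rv w l t last :
  run rv l t last w -> (forall s, l = inl s -> s \notin [:: 0; 2; 3]%N) ->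
  cyc_path (match l with inl _ => 0%N | inr (_, j) => j end) w.
Proof.
elim: w l t last => // a w IH l t last [t' [g [l' [_ lE _ r]]]] hl.
have [[tr [trin am E]]|] := auto_edgesP lE; last first.
  by rewrite mem_cat => /orP[] /pin_edgesP[] [e _ _ _];
    have := hl _ e; rewrite !inE.
case: E => el _ el'.
have -> : match l with inl _ => 0%N | inr (_, j) => j end = a.
  by rewrite el /macro_loc; case: eqP.
rewrite /= eqxx /=; have := IH _ _ _ r; rewrite el'.
case: ifP => _; apply => // s [<-].
by have /orP[/eqP->|] := macro_dst trin; case: tr.2 => [|[|[|[|?]]]].
Qed.

Lemma cyc_path_prefix j w : (j < m)%N -> cyc_path j w ->
  exists k w2, w ++ w2 = iota j (m - j) ++ cycles k.
Proof.
elim: w j => [|a w IH] j jm.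
  by exists 0%N, (iota j (m - j) ++ cycles 0).
rewrite /=; case/andP => /eqP-> {a}; case: eqP => [jm'|/eqP jm'] /IH.
  move=> /(_ isT)[k [w2 e]]; exists k.+1, w2.
  by rewrite e subn0 -[X in (X - j)%N]jm' subSnn.
have jm2 : (j.+1 < m)%N by rewrite ltn_neqAle jm'.
move=> /(_ jm2)[k [w2 e]]; exists k, w2.
by rewrite e -(subnSK jm).
Qed.

Definition same_pins rv rv' : Prop :=
  [/\ rv (inl pK) = rv' (inl pK), rv (inl pC) = rv' (inl pC) &
      forall z, rv (inr z) = rv' (inr z)].

Lemma same_pins_holds rv rv' a l q e t last : same_pins rv rv' ->
  q \in [:: pK; pC] -> e \in pin_edges a l q ->
  holds rv t last e.1.1.2 = holds rv' t last e.1.1.2.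
Proof.
move=> [eK eC ez] qin.
have eq : rv (inl q) = rv' (inl q).
  by move: qin; rewrite !inE => /orP[] /eqP->.
by case/pin_edgesP => -> /=; rewrite /holds /= ?ez ?eq.
Qed.

Lemma pin_run rv rv' w l t last : same_pins rv rv' ->
  l \in [:: inl 2; inl 3; inl 4] -> run rv l t last w -> run rv' l t last w.
Proof.
move=> same; elim: w l t last => // a w IH l t last lin.
move=> [t' [g [l' [tt' lE hg r]]]].
have [[tr [trin am [el _ _]]]|lE'] := auto_edgesP lE.
  have := macro_src trin; move: lin; rewrite el /macro_loc; case: eqP => _.
    by rewrite !in_cons => /or4P[/eqP[->]|/eqP[->]|/eqP[->]|].
  by rewrite !in_cons => /or4P[].
exists t', g, l'; split=> //.
- by move: lE'; rewrite mem_cat => /orP[] lE';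
    rewrite -(same_pins_holds _ _ same _ lE').
- apply: IH r; move: lE' lin; rewrite mem_cat.
  by move=> /orP[] /pin_edgesP[] [-> _ _ ->].
Qed.

(** A first letter 0 commits the word to be a prefix of the cyclic word, readable under [rv'] by
    hypothesis. Any other first letter enters a gadget, where only the pinned values matter.
    Language equality uses this in both directions. *)
Lemma run_transfer rv rv' w : same_pins rv rv' ->
  (forall k, run rv' (inl 0%N) 0 (fun=> 0) (cycles k)) ->
  run rv (inl 0%N) 0 (fun=> 0) w -> run rv' (inl 0%N) 0 (fun=> 0) w.
Proof.
move=> same full; case: w => // a w [t' [g [l' [tt' lE hg r]]]].
have [[tr [trin am [el _ el']]]|lE'] := auto_edgesP lE.
  have a0 : a = 0%N by move: el; rewrite /macro_loc; case: eqP.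
  rewrite {}el' a0 /= in r.
  have [//||k [w2 e]] := @cyc_path_prefix 0%N (a :: w).
    by rewrite a0 /=; apply: (run_cyc_path r).
  by apply: (@trun_prefix _ _ _ _ _ _ _ _ _ w2); rewrite e; apply: (full k.+1).
exists t', g, l'; split=> //.
  by move: lE'; rewrite mem_cat => /orP[] lE';
    rewrite -(same_pins_holds _ _ same _ lE').
apply: pin_run same _ r.
by move: lE'; rewrite mem_cat => /orP[] /pin_edgesP[] [] // _ _ ->.
Qed.

(* In a gadget the letter 3 is read once per time unit, and clock 0 shows the
   total time. *)
Definition pin_word (a k : nat) : seq nat := a :: nseq k 3%N ++ [:: 0%N].

Definition pins : seq (nat * nat * 'I_5) := [:: (1, 2, pK); (2, 3, pC)]%N.

Lemma pinsP x : x \in pins -> x = (1, 2, pK)%N \/ x = (2, 3, pC)%N.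
Proof. by rewrite /pins in_cons mem_seq1 => /orP[] /eqP->; [left|right]. Qed.

Lemma pin_edges_in a l q e : (a, l, q) \in pins -> e \in pin_edges a l q ->
  e \in auto_edges n mtr lf.
Proof.
move=> pin ein; rewrite /auto_edges [_ \in _]mem_cat [X in _ || X]mem_cat.
apply/orP; right; apply/orP.
by case: (pinsP pin) ein => -[-> -> ->] ein; [left|right].
Qed.

Lemma pin_edges_inv a l q l0 g b l1 : (a, l, q) \in pins ->
  (l0, g, b, l1) \in auto_edges n mtr lf ->
  (l0 = inl 0%N /\ b = a) \/ l0 = inl l ->
  (l0, g, b, l1) \in pin_edges a l q.
Proof.
move=> pin lE src; have [[tr [trin bm [el _ _]]]|] := auto_edgesP lE.
  exfalso; have := macro_src trin; move: src; rewrite el /macro_loc.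
  case: eqP => [->|_] [[]|] //.
    by move=> _ a0; case: (pinsP pin) a0 => -[-> _ _].
  by case=> ->; case: (pinsP pin) => -[_ -> _].
rewrite mem_cat => /orP lE1.
case: (pinsP pin) src => -[-> -> ->] src; case: lE1 => lE1.
- exact: lE1.
- by case/pin_edgesP: lE1 => -[e1 e2 e3 e4]; move: src; rewrite e1 e3;
    case=> -[].
- by case/pin_edgesP: lE1 => -[e1 e2 e3 e4]; move: src; rewrite e1 e3;
    case=> -[].
- exact: lE1.
Qed.

Lemma pin_word_intro rv a l q k : (a, l, q) \in pins ->
  rv (inr 0) = 0 -> rv (inr 1) = 1 -> rv (inl q) = k%:R ->
  run rv (inl 0%N) 0 (fun=> 0) (pin_word a k).
Proof.
move=> pin rz rz1 rq.
exists 0, [:: (0%N, OpLe, inr 0)], (inl l); split=> //.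
- by apply: (pin_edges_in pin); rewrite /pin_edges in_cons eqxx.
- by rewrite /holds /= rz subr0 lexx.
have a3 : a != 3%N /\ a != 0%N.
  by case: (pinsP pin) => -[-> _ _].
have H j t last : last 3%N = t -> last 0%N = 0 -> rv (inl q) = t + j%:R ->
    run rv (inl l) t last (nseq j 3%N ++ [:: 0%N]).
  elim: j t last => [|j IH] t last l3 l0 e.
    exists t, (clock_eq 0 (inl q) ++ [:: (3%N, OpLe, inr 0)]), (inl 4%N).
    split=> //.
      by apply: (pin_edges_in pin); rewrite /pin_edges !in_cons eqxx !orbT.
    rewrite holds_cat holds_clock_eq /holds /= l3 l0 rz e.
    by rewrite subrr subr0 addr0 eqxx lexx.
  exists (t + 1), (clock_eq 3 (inr 1)), (inl l); split.
  - by rewrite lerDl.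
  - by apply: (pin_edges_in pin); rewrite /pin_edges !in_cons eqxx !orbT.
  - by rewrite holds_clock_eq l3 rz1 addrC addKr.
  - by apply: IH; rewrite ?/upd ?eqxx //= e -natr1; lra.
by apply: H; rewrite /upd ?add0r //; case: ifP => //.
Qed.

(** All dates are forced: the first letter comes at 0, each 3 one unit later, and the last letter
    without delay, so clock 0 shows [k] when it is compared with [q]. *)
Lemma pin_word_elim rv a l q k : (a, l, q) \in pins ->
  rv (inr 0) = 0 -> rv (inr 1) = 1 ->
  run rv (inl 0%N) 0 (fun=> 0) (pin_word a k) -> rv (inl q) = k%:R.
Proof.
move=> pin rz rz1 [t0 [g [l' [t00 lE hg r]]]].
have a3 : a != 3%N /\ a != 0%N.
  by case: (pinsP pin) => -[-> _ _].
have l0 : l != 0%N.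
  by case: (pinsP pin) => -[_ -> _].
have l4 : l != 4%N.
  by case: (pinsP pin) => -[_ -> _].
have H j t last : last 3%N <= t -> last 0%N = 0 ->
    run rv (inl l) t last (nseq j 3%N ++ [:: 0%N]) -> t = last 3%N ->
    rv (inl q) = t + j%:R.
  elim: j t last => [|j IH] t last l3 l00 [t' [g1 [l1 [tt' lE1 hg1 r1]]]] tl.
    have := pin_edges_inv pin lE1 (or_intror erefl).
    case/pin_edgesP => -[] // e; first by rewrite e in l0.
    move: hg1; rewrite e /holds /= l00 rz -tl => /and4P[] + + + _ _; lra.
  have := pin_edges_inv pin lE1 (or_intror erefl).
  case/pin_edgesP => -[] //; first by move=> e; rewrite e in l0.
  move=> e el; move: hg1; rewrite e holds_clock_eq rz1 -tl => /eqP t1.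
  rewrite el in r1; have -> := IH t' (upd last 3%N t') (lexx _) l00 r1 erefl.
  by rewrite -natr1; lra.
have := pin_edges_inv pin lE (or_introl (conj erefl erefl)).
case/pin_edgesP => -[] //.
- move=> e el; rewrite el in r; move: hg; rewrite e /holds /= rz subr0 andbT.
  move=> t0le; have t0E : t0 = 0 by apply/le_anti/andP.
  rewrite t0E in r.
  have u b : upd (fun=> 0 : R) a 0 b = 0 by rewrite /upd; case: ifP.
  by rewrite (H _ _ _ _ _ r) ?u ?add0r.
- by move=> e; rewrite -e in l0.
- by move=> e; rewrite -e in l0.
Qed.

End Languages.

(** * Cycles of the automaton against steps of the machine *)

Section Simulation.
Variables (n : nat) (mtr : seq transition) (lf : nat) (R : realType).
Hypothesis regs_below : forall p o q, (p, o, q) \in mtr -> (o.2 <= n)%N.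
Local Open Scope ring_scope.
Variable rv : operand -> R.
Hypothesis rv0 : rv (inr 0) = 0.
Hypothesis rv1 : rv (inr 1) = 1.
Local Notation run := (trun (auto_edges n mtr lf) rv).
Local Notation macros := (macro_list mtr lf).
Local Notation m := (nletters n).
Local Notation cyc := (cyc n).
Local Notation cycles := (cycles n).

Definition gaps (last : nat -> R) (f : regs) : Prop :=
  forall i, (i < n.+2)%N -> last i.*2.+1 - last i.*2 = (f i)%:R.

Definition with_count (c : regs) (k : nat) : regs := upd c n.+1 k.

Lemma macro_guard_even o i :
  macro_guard n (inr o) i.*2 = clock_eq i.*2 (inl (shift_param n o i)).
Proof. by rewrite /macro_guard odd_double doubleK. Qed.

Lemma macro_guard_odd o i : macro_guard n (inr o) i.*2.+1 =
  clock_eq i.*2.+1 (inl pM) ++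
  (if (o.1 == KZero) && (i == o.2) then [:: (i.*2, OpLe, inr 0)] else [::]).
Proof.
by rewrite /macro_guard oddS odd_double -[_./2]/(uphalf i.*2) uphalf_double.
Qed.

Lemma macro_guard_load i : macro_guard n (inl 1%N) i.*2.+1 =
  clock_eq i.*2 (input_operand i).
Proof.
by rewrite /macro_guard oddS odd_double -[_./2]/(uphalf i.*2) uphalf_double.
Qed.

Section ShiftParams.
Hypothesis rvL : rv (inl pL) = rv (inl pM) - 1.
Hypothesis rvH : rv (inl pH) = rv (inl pM) + 1.

Lemma shift_paramE o c c' k i : op_rel o c c' -> (o.2 <= n)%N ->
  (with_count c' k.+1 i)%:R =
  (with_count c k i)%:R + rv (inl pM) - rv (inl (shift_param n o i)) :> R.
Proof.
rewrite /with_count /upd /shift_param; case: eqP => [_|ne] oc on.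
  by rewrite rvL -natr1; lra.
case: o oc on => [[] r] /=; rewrite /op_rel /=.
- move=> -> rn; rewrite /upd; case: eqP => [->|_]; last by lra.
  by rewrite rvL -natr1; lra.
- move=> [c0 ->] rn; rewrite /upd; case: eqP => [->|_]; last by lra.
  by rewrite rvH -[in RHS](prednK c0) -natr1; lra.
- by move=> [_ ->] _; lra.
- by move=> -> _; lra.
Qed.

Lemma shift_param_le o i : rv (inl (shift_param n o i)) <= rv (inl pH).
Proof.
rewrite /shift_param; case: ifP => _; first by rewrite rvL rvH; lra.
by case: o.1; try case: ifP => _; rewrite ?rvL ?rvH; lra.
Qed.

Lemma cycle_guard_even o t last last' i : cycle_run n rv (inr o) t last last' ->
  (i < n.+2)%N -> last' i.*2 = last i.*2 + rv (inl (shift_param n o i)).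
Proof.
move=> [_ _ _ hg] lt_in; have im : (i.*2 < m)%N by rewrite /nletters; lia.
have := hg _ im; rewrite macro_guard_even holds_clock_eq ltnn => /eqP <-.
by rewrite addrC subrK.
Qed.

Lemma cycle_guard_odd o t last last' i : cycle_run n rv (inr o) t last last' ->
  (i < n.+2)%N -> last' i.*2.+1 = last i.*2.+1 + rv (inl pM) /\
  (o = (KZero, i) -> last' i.*2.+1 <= last' i.*2).
Proof.
move=> [_ _ _ hg] lt_in; have im : (i.*2.+1 < m)%N by rewrite /nletters; lia.
have := hg _ im; rewrite macro_guard_odd holds_cat holds_clock_eq.
rewrite ltnn => /andP[/eqP <- hz]; split; first by rewrite addrC subrK.
move=> oz; move: hz; rewrite oz eqxx eqxx /holds /= leqnn rv0 andbT.
by rewrite subr_le0.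
Qed.

Lemma monotone_upto (last : nat -> R) i j :
  (forall k, (k.+1 < m)%N -> last k <= last k.+1) ->
  (i <= j)%N -> (j < m)%N -> last i <= last j.
Proof.
move=> mono; elim: j => [|j IH]; first by rewrite leqn0 => /eqP->.
rewrite leq_eqVlt => /predU1P[->//|ij jm].
by apply: le_trans (IH ij (ltnW jm)) (mono _ jm).
Qed.

Lemma cycle_sound o c k last last' : (o.2 <= n)%N ->
  gaps last (with_count c k) ->
  (forall j, (j.+1 < m)%N -> last j <= last j.+1) ->
  cycle_run n rv (inr o) (last m.-1) last last' ->
  exists c', [/\ op_rel o c c', gaps last' (with_count c' k.+1) &
                 k%:R <= rv (inl pH)].
Proof.
move=> on Hg mono Hc.
have dif i : (i < n.+2)%N -> last' i.*2.+1 - last' i.*2 =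
    (with_count c k i)%:R + rv (inl pM) - rv (inl (shift_param n o i)).
  move=> lti; rewrite (cycle_guard_even Hc lti) (cycle_guard_odd Hc lti).1.
  by rewrite -(Hg _ lti); lra.
(* The gap [k] of the cycle counter ends at the last letter of the old cycle. It fits between letter
   0 of the old cycle and letter 0 of the new one, which are at most [pH] apart. *)
have kH : k%:R <= rv (inl pH).
  have g0 := cycle_guard_even Hc (isT : 0 < n.+2)%N.
  have gk := Hg _ (ltnSn n.+1); rewrite /with_count /upd eqxx in gk.
  have le0 := shift_param_le o 0.
  have leS : last 0%N <= last n.+1.*2.
    by apply: monotone_upto => //; rewrite /nletters; lia.
  case: Hc => + _ _ _; rewrite g0 /= /nletters /=.
  by move: gk leS; rewrite doubleS /=; lra.
have [c' oc] : exists c', op_rel o c c'.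
  case: o on Hc {dif} (dif o.2) => [[] r] /= rn Hc dr; rewrite /op_rel /=.
  - by exists (upd c r (c r).+1).
  - have rn2 : (r < n.+2)%N by lia.
    exists (upd c r (c r).-1); split=> //.
    have := dr rn2; rewrite /with_count /upd /shift_param /= eqxx.
    have -> : (r == n.+1) = false by apply/eqP; lia.
    (* Decrementing a zero counter would give a gap of -1, but z_r is read after x_r. *)
    have ge0 : 0 <= last' r.*2.+1 - last' r.*2.
      rewrite subr_ge0; case: Hc => _ mono' _ _; apply: mono'.
      by rewrite /nletters; lia.
    by case: (c r) => // e; exfalso; move: e ge0; rewrite rvH; lra.
  - have rn2 : (r < n.+2)%N by lia.
    exists c; split=> //.
    have := dr rn2; rewrite /with_count /upd /shift_param /=.
    have -> : (r == n.+1) = false by apply/eqP; lia.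
    (* A zero test keeps the gap, and its guard makes the new gap at most 0. *)
    have := (cycle_guard_odd Hc rn2).2 erefl => le e.
    have : (c r)%:R <= 0 :> R by lra.
    by rewrite lern0 => /eqP.
  - by exists c.
exists c'; split=> // i lti.
by rewrite dif // (shift_paramE k i oc on).
Qed.

(** Each cycle executes a transition and increments the count, so the last of [k.+1] cycles starts
    with count [r + k], unless [lf] is met before. *)
Lemma simulation_sound k p c r t last : 
  gaps last (with_count c r) ->
  (forall j, (j.+1 < m)%N -> last j <= last j.+1) ->
  t = last m.-1 -> run (inl (p + 5)%N) t last (cycles k.+1) ->
  (exists c', star mtr (p, c) (lf, c')) \/ (r + k)%:R <= rv (inl pH).
Proof.
elim: k p c r t last => [|k IH] p c r t last Hg mono ->.
all: move=> /cycle_elim[||lab [s' [last' [trin Hc rn]]]]; try (by apply/eqP; lia).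
all: move: trin; rewrite !in_cons.
(* Only the free loop, in which case [p] is [lf], and the machine transitions leave a location
   [p + 5]. *)
all: case/or4P => [/eqP[]|/eqP[]|/eqP[]|/orP[/eqP[ep _ _]|]]; try lia.
all: try by left; exists c; have -> : p = lf; [lia|apply: star_refl].
all: move=> /mapP[[[p0 o] q] tin [ep elab es]]; have {}ep : p0 = p by lia.
all: subst p0 lab s'.
all: have [c' [oc Hg' kH]] := cycle_sound (regs_below tin) Hg mono Hc.
  by right; rewrite addn0.
have [_ mono' _ _] := Hc.
have [[c2 st]|le] := IH q c' r.+1 _ last' Hg' mono' erefl rn.
  by left; exists c2; apply: star_step st; exists o.
by right; rewrite addnS -addSn.
Qed.

End ShiftParams.

(* In a cycle starting at [theta], the [i]-th pair of letters owns the window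
   from [theta + i * B] to [theta + (i + 1) * B]. *)
Definition layout (B : nat) (theta : R) (f : regs) (j : nat) : R :=
  if (j < m)%N then
    theta + (j./2.+1 * B)%:R - (if odd j then 0 else (f j./2)%:R)
  else 0.

Lemma layout_even B theta f i : (i < n.+2)%N ->
  layout B theta f i.*2 = theta + (i.+1 * B)%:R - (f i)%:R.
Proof.
by move=> lti; rewrite /layout odd_double doubleK ifT // /nletters; lia.
Qed.

Lemma layout_odd B theta f i : (i < n.+2)%N ->
  layout B theta f i.*2.+1 = theta + (i.+1 * B)%:R.
Proof.
move=> lti; rewrite /layout /= odd_double uphalf_double subr0 ifT //.
by rewrite /nletters; lia.
Qed.

Lemma parity_ind (P : nat -> Prop) :
  (forall i, P i.*2) -> (forall i, P i.*2.+1) -> forall j, P j.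
Proof.
move=> H0 H1 j; rewrite -(odd_double_half j).
by case: (odd j); [apply: H1|apply: H0].
Qed.

(** A counter bounded by [B] keeps x_i inside its own window. *)
Lemma layout_mono B theta f j : (forall i, (i < n.+2)%N -> (f i <= B)%N) ->
  (j.+1 < m)%N -> layout B theta f j <= layout B theta f j.+1.
Proof.
move=> fB; elim/parity_ind: j => i jm.
all: have lti : (i < n.+2)%N by rewrite /nletters in jm; lia.
  by rewrite layout_even ?layout_odd // lerBlDr lerDl ler0n.
have lti1 : (i.+1 < n.+2)%N by rewrite /nletters in jm; lia.
rewrite layout_odd // -doubleS layout_even // -addrA lerD2l lerBrDr -natrD ler_nat.
by rewrite [(i.+2 * B)%N]mulSnr leq_add2l fB.
Qed.

Lemma layout_bounds B theta f : (forall i, (i < n.+2)%N -> (f i <= B)%N) ->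
  theta <= layout B theta f 0 /\ layout B theta f m.-1 = theta + (n.+2 * B)%:R.
Proof.
move=> fB; split.
  by rewrite -[0%N]double0 layout_even // mul1n -addrA lerDl subr_ge0 ler_nat fB.
by rewrite -[m.-1]/(n.+1.*2.+1) layout_odd.
Qed.

Section Completeness.
Variable B : nat.
Hypothesis rvL : rv (inl pL) = (n.+2 * B)%:R - 1.
Hypothesis rvM : rv (inl pM) = (n.+2 * B)%:R.
Hypothesis rvH : rv (inl pH) = (n.+2 * B)%:R + 1.

(** The period is exactly [n.+2] windows, so the next cycle starts at [theta + rv (inl pM)], the
    date at which the current one ends. *)
Lemma step_cycle o c c' k theta : op_rel o c c' -> (o.2 <= n)%N ->
  (forall i, (i < n.+2)%N -> (with_count c k i <= B)%N) ->
  (forall i, (i < n.+2)%N -> (with_count c' k.+1 i <= B)%N) ->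
  cycle_run n rv (inr o) (layout B theta (with_count c k) m.-1)
    (layout B theta (with_count c k))
    (layout B (theta + rv (inl pM)) (with_count c' k.+1)).
Proof.
move=> oc on cB cB'.
have rvL' : rv (inl pL) = rv (inl pM) - 1 by rewrite rvM.
have rvH' : rv (inl pH) = rv (inl pM) + 1 by rewrite rvM.
split.
- by rewrite (layout_bounds _ cB).2 -rvM; apply: (layout_bounds _ cB').1.
- by move=> j; apply: layout_mono.
- by move=> j; rewrite leqNgt /layout => /negbTE->.
elim/parity_ind => i im.
all: have lti : (i < n.+2)%N by rewrite /nletters in im; lia.
  rewrite macro_guard_even holds_clock_eq ltnn !layout_even //.
  by apply/eqP; rewrite (shift_paramE rvL' rvH' k i oc on); lra.
rewrite macro_guard_odd holds_cat holds_clock_eq ltnn !layout_odd //.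
apply/andP; split; first by apply/eqP; lra.
case: ifP => // /andP[/eqP oz /eqP oi].
rewrite /holds /= leqnn layout_even // rv0 andbT.
have [ci ec] : c i = 0%N /\ c' = c by move: oc; rewrite /op_rel oz -oi.
have -> : with_count c' k.+1 i = 0%N.
  by rewrite /with_count /upd; case: eqP => [e|_]; [lia|rewrite ec].
lra.
Qed.

Lemma load_cycle t last f :
  (forall i, (i < n.+2)%N -> (f i)%:R = rv (input_operand i)) ->
  (forall i, (i < n.+2)%N -> (f i <= B)%N) ->
  (forall j, (m <= j)%N -> last j = 0) ->
  cycle_run n rv (inl 1%N) t last (layout B t f).
Proof.
move=> fi fB out; split.
- exact: (layout_bounds _ fB).1.
- by move=> j; apply: layout_mono.
- by move=> j mj; rewrite out // /layout ltnNge mj.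
elim/parity_ind => i im.
all: have lti : (i < n.+2)%N by rewrite /nletters in im; lia.
  by rewrite /= odd_double.
rewrite macro_guard_load holds_clock_eq leqnn layout_odd //.
by rewrite layout_even // -fi //; apply/eqP; lra.
Qed.

Definition check_dates (j : nat) : R :=
  match j with
  | 0 => rv (inl pL)
  | 1 => rv (inl pM)
  | _ => if (j < m)%N then rv (inl pH) else 0
  end.

Lemma check_cycle : (0 < B)%N ->
  cycle_run n rv (inl 0%N) 0 (fun=> 0) check_dates.
Proof.
move=> B0; have ge1 : 1 <= (n.+2 * B)%:R :> R.
  by rewrite (ler_nat _ 1) muln_gt0 B0.
split.
- by rewrite /= rvL subr_ge0.
- move=> [|[|j]] jm.
  + by rewrite /= rvL rvM; lra.
  + by rewrite /= rvM rvH; lra.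
  + by rewrite /check_dates jm (ltnW jm).
- by move=> [|[|j]] // jm; rewrite /= ltnNge jm.
- move=> [|[|[|j]]] jm; rewrite ?holds_cat ?holds_clock_eq //=.
  + by rewrite subr0.
  + by rewrite subr0 eqxx rv1 rvL rvM; apply/eqP; lra.
  + by rewrite subr0 eqxx rv1 rvM rvH; apply/eqP; lra.
Qed.

End Completeness.

End Simulation.

(** * Reduction from halting to language preservation *)

Section Machine.
Variables (n : nat) (mtr : seq transition) (lf : nat) (R : realType).
Hypothesis n_gt0 : (0 < n)%N.
Hypothesis regs_below : forall p o q, (p, o, q) \in mtr -> (o.2 <= n)%N.
Local Open Scope ring_scope.
Implicit Types (rv : operand -> R).
Local Notation run rv := (trun (auto_edges n mtr lf) rv).
Local Notation macros := (macro_list mtr lf).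
Local Notation m := (nletters n).
Local Notation cyc := (cyc n).
Local Notation cycles := (cycles n).

Definition input_regs (K C : nat) : regs :=
  fun i => match i with 0 => K | 1 => C | _ => 0 end.

Definition scaled rv (B : nat) : Prop :=
  [/\ rv (inl pL) = (n.+2 * B)%:R - 1, rv (inl pM) = (n.+2 * B)%:R &
      rv (inl pH) = (n.+2 * B)%:R + 1].

Lemma bounded_regs (f : regs) :
  exists B, forall i, (i < n.+2)%N -> (f i <= B)%N.
Proof.
exists (\sum_(i < n.+2) f i)%N => i lti.
by rewrite (bigD1 (Ordinal lti)) //= leq_addr.
Qed.

(** A finite computation has bounded counters, so any window at least as long as the largest of them
    works throughout; once [lf] is reached the automaton reads freely. *)
Lemma simulation_complete x y k : star mtr x y -> y.1 = lf ->
  exists B0, forall B, (B0 <= B)%N ->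
    (forall i, (i < n.+2)%N -> (with_count n x.2 k i <= B)%N) /\
    forall rv theta N, rv (inr 0) = 0 -> scaled rv B ->
      run rv (inl (x.1 + 5)%N) (layout n B theta (with_count n x.2 k) m.-1)
        (layout n B theta (with_count n x.2 k)) (cycles N).
Proof.
move=> st; elim: st k => {x y} [x|x u y [o oin oc] _ IH] k ylf.
  have [B0 B0P] := bounded_regs (with_count n x.2 k).
  exists B0 => B B0B; split=> [i lti|rv theta N _ _].
    exact: leq_trans (B0P i lti) B0B.
  by rewrite ylf; apply: free_run.
have [B1 B1P] := IH k.+1 ylf.
have [B0 B0P] := bounded_regs (with_count n x.2 k).
exists (maxn B0 B1) => B; rewrite geq_max => /andP[B0B B1B].
have [uB IHr] := B1P B B1B.
have xB i : (i < n.+2)%N -> (with_count n x.2 k i <= B)%N.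
  by move=> lti; apply: leq_trans (B0P i lti) B0B.
split=> // rv theta [//|N] rv0 sc; have [rvL rvM rvH] := sc.
apply: (@cycle_intro _ _ _ _ _ _ (inr o) (u.1 + 5)%N _ _
  (layout n B (theta + rv (inl pM)) (with_count n u.2 k.+1))).
- rewrite /macro_list !in_cons; apply/orP; right; apply/orP; right.
  apply/orP; right; apply/orP; right; apply/mapP.
  by exists (x.1, o, u.1).
- by apply: step_cycle => //; apply: (regs_below oin).
- exact: IHr.
Qed.

Lemma machine_complete K C c : star mtr (0%N, input_regs K C) (lf, c) ->
  exists2 B, (0 < B)%N & forall rv, rv (inr 0) = 0 -> rv (inr 1) = 1 ->
    rv (inl pK) = K%:R -> rv (inl pC) = C%:R -> scaled rv B ->
    forall N, run rv (inl 0%N) 0 (fun=> 0) (cycles N).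
Proof.
move=> /simulation_complete-/(_ 0%N erefl)[B0 B0P]; exists B0.+1 => //.
move=> rv rv0 rv1 rvK rvC sc; have [rvL rvM rvH] := sc.
have [fB IH] := B0P _ (leqnSn B0).
have fE i : (with_count n (input_regs K C) 0 i)%:R = rv (input_operand i).
  rewrite /with_count /upd; case: eqP => [->|_].
    (* As [n] is positive, the cycle counter [n.+1] is at least 2, hence distinct from the input
       counters and loaded with 0. *)
    by case: n n_gt0.
  by case: i => [|[|i]] /=; rewrite ?rvK ?rvC ?rv0.
have chk := check_cycle rv1 rvL rvM rvH (isT : 0 < B0.+1)%N.
suff r1 N :
    run rv (inl 1%N) (check_dates n rv m.-1) (check_dates n rv) (cycles N).
  by case=> [//|N]; apply: (cycle_intro _ chk (r1 N)).
case: N => [//|N].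
apply: (cycle_intro _ (load_cycle _ _ fB _) (IH rv _ N rv0 sc)).
- by rewrite /macro_list !in_cons eqxx orbT.
- by move=> i _; apply: fE.
- by move=> [|[|j]] //; rewrite leqNgt => /negbTE /= ->.
Qed.

(** Of the [N.+3] cycles, one checks the parameters and one loads the inputs; the other [N.+1] are
    simulated. Nonzero period parameters exclude the free mode at the start. *)
Lemma machine_sound rv K C N : rv (inr 0) = 0 -> rv (inr 1) = 1 ->
  rv (inl pK) = K%:R -> rv (inl pC) = C%:R ->
  0 <= rv (inl pL) -> 0 <= rv (inl pM) -> 0 <= rv (inl pH) ->
  ~ [/\ rv (inl pL) = 0, rv (inl pM) = 0 & rv (inl pH) = 0] ->
  run rv (inl 0%N) 0 (fun=> 0) (cycles N.+3) ->
  (exists c, star mtr (0%N, input_regs K C) (lf, c)) \/ N%:R <= rv (inl pH).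
Proof.
move=> rv0 rv1 rvK rvC L0 M0 H0 nz.
case/cycle_elim => // lab [s' [last [trin [_ mono _ hg] r]]].
move: trin; rewrite /macro_list !in_cons.
case/or4P => [/eqP[el es]|/eqP[]|/eqP[el es]|/orP[/eqP[]|/mapP[? _ []]]] //; try lia.
  have := hg 0%N isT; rewrite el holds_clock_eq /= subr0 => /eqP hL.
  have := hg 1%N isT; rewrite el holds_cat !holds_clock_eq /= subr0.
  move=> /andP[/eqP hM /eqP h1].
  have := hg 2 isT; rewrite el holds_cat !holds_clock_eq /= subr0.
  move=> /andP[/eqP hH /eqP h2].
  move: r; rewrite es => /cycle_elim[] // lab2 [s2 [last2 [trin [_ mono2 _]]]].
  move=> hg2 r.
  move: trin; rewrite /macro_list !in_cons.
  case/or4P => [/eqP[]|/eqP[el2 es2]|/eqP[]|/orP[/eqP[]|/mapP[? _ []]]] //; try lia.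
  rewrite es2 in r; rewrite -[N]add0n.
  apply: (@simulation_sound n mtr lf R regs_below rv rv0 _ _ N 0 _ 0 _ last2
    _ mono2 erefl r) => //.
  - by move: h1; rewrite rv1 hL hM; lra.
  - by move: h2; rewrite rv1 hM hH; lra.
  move=> i lti; have im : (i.*2.+1 < m)%N by rewrite /nletters; lia.
  have := hg2 _ im; rewrite el2 macro_guard_load holds_clock_eq leqnn => /eqP->.
  rewrite /with_count /upd; case: eqP => [->|_].
    by case: n n_gt0.
  by case: i {im lti} => [|[|i]] /=; rewrite ?rvK ?rvC ?rv0.
exfalso; apply: nz; have := hg 0%N isT; rewrite el /holds /= rv0 subr0.
by move=> /and5P[hL hM hH h0 _]; split; lra.
Qed.

Definition machine_pera := enc_pera n.*2.+3 (auto_edges n mtr lf) (inl 0%N).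

Definition nat_valuation (s : seq nat) : param_valuation 'I_5 :=
  [ffun j : 'I_5 => ((nth 0%N s j)%:R : rat)%:nng].

(** The three period parameters get the default 0 of [nth], which opens the free mode. *)
Definition machine_instance (K C : nat) : lp_instance :=
  LPInstance machine_pera (nat_valuation [:: K; C]).

Lemma nat_valuationE s (j : 'I_5) :
  ratr (inst_operand (nat_valuation s) (inl j)) = (nth 0%N s j)%:R :> R.
Proof. by rewrite /= ffunE /= ratr_nat. Qed.

Lemma ratr_inst_int (v : param_valuation 'I_5) z :
  ratr (inst_operand v (inr z)) = z%:~R :> R.
Proof. by rewrite /= ratr_int. Qed.

Lemma machine_instance_preserved K C :
  language_preservation R (machine_instance K C) <->
  exists c, star mtr (0%N, input_regs K C) (lf, c).
Proof.
set v := nat_valuation [:: K; C].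
pose rvof (v : param_valuation 'I_5) (k : operand) : R :=
  ratr (inst_operand v k).
have full k : run (rvof v) (inl 0%N) 0 (fun=> 0) (cycles k).
  by apply: start_free_run; rewrite /rvof ?nat_valuationE ?ratr_inst_int.
have UL_eq w w' :=
  @UL_eq_trun R _ 'I_5 _ _ (inl 0%N) w w' (@auto_edges_below n mtr lf).
split=> [[v' [nv /(UL_eq v v') eq]]|[c /machine_complete[B B0 BP]]].
  have rK : rvof v' (inl pK) = K%:R.
    apply: (@pin_word_elim n mtr lf R _ 1 2 pK) => //;
      rewrite ?/rvof ?ratr_inst_int //.
    by apply/eq; apply: (@pin_word_intro n mtr lf R _ 1 2 pK) => //;
      rewrite ?nat_valuationE ?ratr_inst_int.
  have rC : rvof v' (inl pC) = C%:R.
    apply: (@pin_word_elim n mtr lf R _ 2 3 pC) => //;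
      rewrite ?/rvof ?ratr_inst_int //.
    by apply/eq; apply: (@pin_word_intro n mtr lf R _ 2 3 pC) => //;
      rewrite ?nat_valuationE ?ratr_inst_int.
  have ge0 j : 0 <= rvof v' (inl j) by rewrite /rvof /= ler0q.
  (* [K] and [C] being pinned, [v'] can differ from [v] only in the period parameters. *)
  have nz : ~ [/\ rvof v' (inl pL) = 0, rvof v' (inl pM) = 0 &
                  rvof v' (inl pH) = 0].
    move=> [L0 M0 H0]; apply: nv; apply/ffunP => j; apply/val_inj.
    apply: (fmorph_inj (@ratr R)) => /=.
    rewrite -[LHS]/(rvof v' (inl j)) ffunE /= ratr_nat.
    case: j => -[|[|[|[|[|j]]]]] jlt //=.
    - by rewrite (bool_irrelevance jlt isT).
    - by rewrite (bool_irrelevance jlt isT).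
    - by rewrite (bool_irrelevance jlt isT).
    - by rewrite (bool_irrelevance jlt isT).
    - by rewrite (bool_irrelevance jlt isT).
  (* More cycles than [pH] can count, so the simulation must halt. *)
  have fl := (eq _).2 (full (Num.bound (rvof v' (inl pH))).+3).
  have [||//|le] := machine_sound _ _ rK rC (ge0 _) (ge0 _) (ge0 _) nz fl.
  - by rewrite /rvof ratr_inst_int.
  - by rewrite /rvof ratr_inst_int.
  - by have := le_lt_trans le (archi_boundP (ge0 pH)); rewrite ltxx.
pose M := (n.+2 * B)%N; have M0 : (0 < M)%N by rewrite muln_gt0.
exists (nat_valuation [:: K; C; M.-1; M; M.+1]); split.
  move=> /(congr1 (fun w : param_valuation 'I_5 => (w pM)%:num)).
  by rewrite !ffunE /= => /eqP; rewrite eqr_nat; lia.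
apply/UL_eq => w; split.
  by apply: run_transfer => //; split; rewrite ?nat_valuationE ?ratr_inst_int.
apply: run_transfer; first by split=> *; rewrite ?nat_valuationE ?ratr_inst_int.
apply: BP; rewrite ?nat_valuationE ?ratr_inst_int //.
split; rewrite nat_valuationE //= -?natr1 //.
by rewrite -[in RHS]/M -[in RHS](prednK M0) -natr1 addrK.
Qed.

(** The valuation is the last entry of the coded list, and the entries before it do not depend on
    [K] and [C]. *)
Lemma code_machine_instance : exists a b, forall K C,
  code_instance (machine_instance K C) =
  (a + b * CodeSeq.code [:: code_inputs K C])%N.
Proof.
have [a [b abP]] := code_affine [:: n.*2.+4;
  (size (locations (auto_edges n mtr lf) (inl 0%N))).+1; 5%N;
  code_pera machine_pera].
exists a, b => K C; rewrite -abP /code_instance /=.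
suff -> : code_valuation (nat_valuation [:: K; C]) = code_inputs K C by [].
rewrite /code_valuation; congr CodeSeq.code.
rewrite (eq_map (g := (fun i => code_nat (nth 0%N [:: K; C] i)) \o val)).
  by rewrite map_comp val_enum_ord.
by move=> j; rewrite ffunE code_rat_nat.
Qed.

End Machine.

(** * Diagonalization *)

Lemma diagonal_machine (f : pfun 1) : partial_recursive f ->
  exists mtr lf, forall K C,
    (f [tuple self_code K C] 0 ->
       exists c, star mtr (0, input_regs K C) (lf, c)) /\
    (f [tuple self_code K C] 1 ->
       ~ exists c, star mtr (0, input_regs K C) (lf, c)).
Proof.
move=> rf.
have := @partial_recursive_comp 2 1 f _ rf (fun=> total_recursive_self_code).
move=> /partial_recursive_implementable-/(_ [tuple 0; 1] 2 3)[|//|//|c cP].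
  by move=> r; rewrite !inE => /orP[]/eqP->.
(* Register 2 holds the answer of [f]; the final zero test lets the machine reach the halting
   location only on answer 0. *)
set tr := compile c 0 ++ [:: (clen c, (KZero, 2), (clen c).+1)].
exists tr, (clen c).+1 => K C.
have ex y : f [tuple self_code K C] y ->
    star tr (0, input_regs K C) (clen c, upd (input_regs K C) 2 y).
  move=> fy; apply: (@compile_correct _ c); last first.
    by move=> x xin; rewrite mem_cat xin.
  apply: cP => //; first by case=> [|[|[|r]]].
  by congr f: fy; apply: eq_from_tnth => i; rewrite (ord1 i) tnth_mktuple.
split=> [/ex st|/ex st [c' st']].
  exists (upd (input_regs K C) 2 0); apply: star_trans st _.
  apply: star_step (star_refl _ _); exists (KZero, 2) => //.
  by rewrite mem_cat inE eqxx orbT.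
have src p o q : (p, o, q) \in tr ->
    p < clen c \/ (p, o, q) = (clen c, (KZero, 2), (clen c).+1).
  by rewrite mem_cat mem_seq1 => /orP[/compile_src|/eqP->]; [left|right].
have det : deterministic tr.
  move=> p o1 q1 o2 q2 i1 i2.
  have [l1|e1] := src _ _ _ i1; have [l2|e2] := src _ _ _ i2.
  - move: i1 i2; rewrite !mem_cat !mem_seq1.
    case/orP => [i1|/eqP[e _ _]]; last by rewrite e ltnn in l1.
    case/orP => [i2|/eqP[e _ _]]; last by rewrite e ltnn in l2.
    exact: compile_det i1 i2.
  - by case: e2 l1 => -> _ _; rewrite ltnn.
  - by case: e1 l2 => -> _ _; rewrite ltnn.
  - by case: e1 e2 => _ -> -> [_ -> ->]; constructor 1.
(* On answer 1 the machine is stuck before the zero test; the halting location is stuck too, so by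
   determinism both cannot be reached. *)
have [] : (clen c, upd (input_regs K C) 2 1) = ((clen c).+1, c').
  apply: star_stuck_unique det _ _ st st' => u [o /= /src[|e]].
  - by rewrite ltnn.
  - by case: e => -> _; rewrite /op_rel /= /upd /= => -[].
  - by lia.
  - by case: e; lia.
by lia.
Qed.

Theorem mainTheorem4 (R : realType) :
  ~ algorithmically_decidable code_instance (language_preservation R).
Proof.
move=> [f [rf fP]].
have [mtr [lf Hm]] := diagonal_machine rf.
(* The sum bounds every register used by the machine, and the successor makes [n] positive. *)
pose n := (\sum_(x <- mtr) x.1.2.2).+1.
have below p o q : (p, o, q) \in mtr -> o.2 <= n.
  by move=> xin; rewrite /n (big_rem _ xin) /=; lia.
(* The affine coefficients of the automaton become the inputs, so that the machine runs [f] on the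
   code of its own instance. *)
have [K [C eKC]] := code_machine_instance n mtr lf.
have P := @machine_instance_preserved n mtr lf R isT below K C.
have [f1 f0] := fP (machine_instance n mtr lf K C).
have [h0 h1] := Hm K C.
have e : code_instance (machine_instance n mtr lf K C) = self_code K C.
  exact: eKC.
rewrite e in f1 f0.
have nQ : ~ language_preservation R (machine_instance n mtr lf K C).
  by move=> Q; apply: (h1 (f1 Q)); apply/P.
exact: (nQ (P.2 (h0 (f0 nQ)))).
Qed.
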